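(* Let $n\ge 3$ and let $\Gamma\subset\mathbb{R}^n$ be an open convex symmetric cone with vertex at the origin such that $\{\lambda:\lambda_i>0,\ 1\le i\le n\}\subset\Gamma\subset\{\lambda:\sum_{i=1}^n\lambda_i>0\}$. Assume that $(1,0,\ldots,0)\in\partial\Gamma$. For $0\le a<b\le\infty$, let $u\in C^0(\{a<|x|<b\})$ be radially symmetric and positive. Then $u$ is a solution of $\lambda(A^u)\in\partial\Gamma$ in $\{a<|x|<b\}$ in the viscosity sense if and only if \[ u(x)=\begin{cases} C_1|x|^{-C_2}\ \text{ with } C_1>0,\ 0\le C_2\le n-2 & \text{if }\mu_\Gamma^+=1,\\[1mm] \big(C_3|x|^{-\mu_\Gamma^++1}+C_4\big)^{\frac{n-2}{\mu_\Gamma^+-1}}\ \text{ with } C_3\ge 0,\ C_4\ge 0,\ C_3+C_4>0 & \text{if }\mu_\Gamma^+\ne 1, \end{cases} \] for some constants $C_1,C_2$ (respectively $C_3,C_4$).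
   Context: $\{a<|x|<b\}=\{x\in\mathbb{R}^n: a<|x|<b\}$. ''Symmetric'' (for $\Gamma$) means invariant under permutations of coordinates. For a positive $C^2$ function $u$, $A^u$ is the symmetric matrix with entries \[ (A^u)_{ij}=-\frac{2}{n-2}u^{-\frac{n+2}{n-2}}\nabla_{ij}u+\frac{2n}{(n-2)^2}u^{-\frac{2n}{n-2}}\nabla_iu\nabla_ju-\frac{2}{(n-2)^2}u^{-\frac{2n}{n-2}}|\nabla u|^2\delta_{ij}, \] and $\lambda(A^u)$ denotes its eigenvalues. Viscosity sense. Let $\Omega\subset\mathbb{R}^n$ be open. A positive lower semicontinuous (resp. upper semicontinuous) real-valued function $u$ on $\Omega$ satisfies $\lambda(A^u)\in\bar\Gamma$ (resp. $\lambda(A^u)\in\mathbb{R}^n\setminus\Gamma$) in $\Omega$ in the viscosity sense if for any $x_0\in\Omega$ and $\varphi\in C^2(\Omega)$ with $(u-\varphi)(x_0)=0$ and $u-\varphi\ge 0$ (resp. $u-\varphi\le 0$) near $x_0$, one has $\lambda(A^\varphi(x_0))\in\bar\Gamma$ (resp. $\lambda(A^\varphi(x_0))\in\mathbb{R}^n\setminus\Gamma$). A positive continuous function $u$ satisfies $\lambda(A^u)\in\partial\Gamma$ in $\Omega$ in the viscosity sense if both $\lambda(A^u)\in\bar\Gamma$ and $\lambda(A^u)\in\mathbb{R}^n\setminus\Gamma$ hold in $\Omega$ in the viscosity sense. The constant $\mu_\Gamma^+\in[0,n-1]$ is the unique number such that $(-\mu_\Gamma^+,1,\ldots,1)\in\partial\Gamma$.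 *)

(* Defs.v *)
From HB Require Import structures.
From mathcomp Require Import all_boot all_order all_algebra all_fingroup.
From mathcomp Require Import all_classical all_reals all_analysis.

Set Implicit Arguments.
Unset Strict Implicit.
Unset Printing Implicit Defensive.

Import Order.TTheory GRing.Theory Num.Theory.
Import numFieldNormedType.Exports.

Local Open Scope classical_set_scope.
Local Open Scope ring_scope.

Section Definitions.
Context {R : realType} {n : nat}.
Implicit Types (x : 'rV[R]_n) (Gamma Omega S : set 'rV[R]_n).
Implicit Types (u phi : 'rV[R]_n -> R).

(* The norm `|x| of the library on row vectors is the sup norm. *)
Definition enorm x : R := Num.sqrt (\sum_(i < n) x 0 i ^+ 2).

Definition annulus (a : R) (b : \bar R) : set 'rV[R]_n :=
  [set x | a < enorm x /\ ((enorm x)%:E < b)%E].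

Definition radially_symmetric_on Omega u :=
  forall x y, Omega x -> Omega y -> enorm x = enorm y -> u x = u y.

Definition boundary S : set 'rV[R]_n := closure S `\` interior S.

Definition is_cone Gamma := forall (t : R) x, 0 < t -> Gamma x -> Gamma (t *: x).

Definition is_symmetric Gamma :=
  forall (s : 'S_n) x, Gamma x -> Gamma (col_perm s x).

Definition positive_cone : set 'rV[R]_n := [set x | forall i, 0 < x 0 i].

Definition positive_trace : set 'rV[R]_n := [set x | 0 < \sum_(i < n) x 0 i].

(* The vector (c, d, ..., d). *)
Definition vec_head_tail (c d : R) : 'rV[R]_n :=
  \row_(i < n) if (i == 0 :> nat)%N then c else d.

Definition mu_plus Gamma : R :=
  get [set m : R | 0 <= m <= n%:R - 1 /\ boundary Gamma (vec_head_tail (- m) 1)].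

Definition partial (i : 'I_n) u : 'rV[R]_n -> R :=
  fun x => 'D_(delta_mx 0 i : 'rV[R]_n) u x.

Definition C2_on Omega phi :=
  [/\ {within Omega, continuous phi},
      forall i, (forall x, Omega x -> derivable phi x (delta_mx 0 i)) /\
                {within Omega, continuous (partial i phi)}
    & forall i j,
        (forall x, Omega x -> derivable (partial j phi) x (delta_mx 0 i)) /\
        {within Omega, continuous (partial i (partial j phi))}].

Definition conformal_hessian u x : 'M[R]_n :=
  let N : R := n%:R in
  \matrix_(i, j)
    (- (2 / (N - 2)) * u x `^ (- ((N + 2) / (N - 2)))
        * partial i (partial j u) x
     + 2 * N / (N - 2) ^+ 2 * u x `^ (- (2 * N / (N - 2)))
        * (partial i u x * partial j u x)
     - 2 / (N - 2) ^+ 2 * u x `^ (- (2 * N / (N - 2)))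
        * (\sum_(k < n) partial k u x ^+ 2) * (i == j)%:R).

(* [l] lists the eigenvalues of [A] with multiplicity; it is unique up to a
   permutation of its coordinates, and exists whenever [A] is symmetric. *)
Definition eigenvalue_vector (A : 'M[R]_n) (l : 'rV[R]_n) :=
  char_poly A = \prod_(i < n) ('X - (l 0 i)%:P).

(* lambda(A) \in S, for S invariant under permutations of coordinates. *)
Definition eigenvalues_in (A : 'M[R]_n) S :=
  exists2 l, eigenvalue_vector A l & S l.

(* The three viscosity notions are meant for [u] positive on the open set
   [Omega], and respectively lower semicontinuous, upper semicontinuous and
   continuous there. *)
Definition viscosity_super Gamma Omega u :=
  forall x0 phi, Omega x0 -> C2_on Omega phi -> u x0 - phi x0 = 0 ->
    (\forall x \near x0, 0 <= u x - phi x) ->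
    eigenvalues_in (conformal_hessian phi x0) (closure Gamma).

Definition viscosity_sub Gamma Omega u :=
  forall x0 phi, Omega x0 -> C2_on Omega phi -> u x0 - phi x0 = 0 ->
    (\forall x \near x0, u x - phi x <= 0) ->
    eigenvalues_in (conformal_hessian phi x0) (~` Gamma).

Definition viscosity_solution Gamma Omega u :=
  viscosity_super Gamma Omega u /\ viscosity_sub Gamma Omega u.

End Definitions.

(* Main.v *)
Require Import Defs.
From mathcomp Require Import all_boot all_order all_algebra all_fingroup.
From mathcomp Require Import all_classical all_reals all_analysis.
From mathcomp Require Import ring lra complex spectral.

Set Implicit Arguments.
Unset Strict Implicit.
Unset Printing Implicit Defensive.

Import Order.TTheory GRing.Theory Num.Theory.
Import numFieldNormedType.Exports.

Local Open Scope classical_set_scope.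
Local Open Scope ring_scope.

(** Write [u x = exp (- m (xi t + t))] with [t = ln |x|] and [m = (n - 2) / 2].
    The eigenvalues of [A^u] are then [d = e^(2 xi) (1 - xi'^2) / 2], [n - 1]
    times, and [c = e^(2 xi) (xi'' - (1 - xi'^2) / 2)].  Since [(1, 0, ..., 0)]
    lies on the boundary of the cone, [(c, d, ..., d)] is in its closure iff
    [d >= 0] and [c >= - mu d], so with [k = (mu - 1) / 2] the equation says that
    [|xi'| <= 1] and [xi'' = - k (1 - xi'^2)] in a viscosity sense; that is,
    [exp (- k xi)] satisfies [h'' = k^2 h] (and [xi] is affine if [k = 0]).

    A viscosity solution [xi] is 1-Lipschitz.  On a segment where its increment
    is not extremal, it coincides with the classical solution [eta] having the
    same end values: [|eta'| < 1], and [eta - e exp (M t)], [eta + e exp (M t)]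
    violate the equation strictly, so they cannot touch [xi] inside the segment
    from above, resp. from below.

    Conversely, if a test function [phi] touches the smooth solution [u] at [x],
    then the quadratic forms of [A^phi] and [A^u] at [x] are ordered.  As [A^u] is
    a rank one perturbation of a scalar matrix, writing one matrix in an
    eigenbasis of the other makes the eigenvalues of [A^phi], resp. [(c, d, ..., d)],
    dominate a convex combination of vectors of the closed cone, resp. the cone. *)

(** * One-dimensional viscosity comparison *)

Section OneDimensional.
Context {R : realType}.
Implicit Types (f g eta xi : R -> R) (s t : R) (I : set R).

(** The derivatives are explicit and live on all of the real line: the comparison argument only
    tests with globally defined functions, obtained by adding an exponential to a line or to a
    classical solution. *)
Record C2_data eta eta1 eta2 : Prop := C2Data {
  C2_der1 : forall t, is_derive t 1 eta (eta1 t);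
  C2_der2 : forall t, is_derive t 1 eta1 (eta2 t);
  C2_cont : continuous eta2 }.

Lemma is_derive_continuous f t df : is_derive t 1 f df -> {for t, continuous f}.
Proof.
by case=> df_ _; apply: differentiable_continuous; apply/derivable1_diffP.
Qed.

Lemma C2_data_continuous {eta eta1 eta2} : C2_data eta eta1 eta2 ->
  continuous eta /\ continuous eta1.
Proof. by case=> h1 h2 _; split=> t; apply: is_derive_continuous. Qed.

Lemma C2_dataD {f f1 f2 g g1 g2} : C2_data f f1 f2 -> C2_data g g1 g2 ->
  C2_data (f \+ g) (f1 \+ g1) (f2 \+ g2).
Proof.
move=> [F1 F2 F3] [G1 G2 G3]; split=> t; first exact: is_deriveD.
  exact: is_deriveD.
by apply: cvgD; [exact: F3|exact: G3].
Qed.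

Lemma C2_data_exp (c M s : R) :
  C2_data (fun t => c * expR (M * (t - s)))
          (fun t => c * M * expR (M * (t - s)))
          (fun t => c * M ^+ 2 * expR (M * (t - s))).
Proof.
have D c' t : is_derive t (1 : R) (fun t => c' * expR (M * (t - s)))
    (c' * M * expR (M * (t - s))).
  apply: is_derive_eq.
  by rewrite /GRing.scale /= ?scaler0 ?addr0 ?add0r; ring.
split=> t.
- exact: D.
- by have := D (c * M) t; rewrite -[c * M * M]mulrA -expr2.
- exact: is_derive_continuous (D _ _).
Qed.

Lemma C2_data_affine (a b : R) :
  C2_data (fun t => a + b * t) (fun=> b) (fun=> 0).
Proof.
split=> t; last exact: cvg_cst.
  apply: is_derive_eq.
  by rewrite /GRing.scale /= ?scaler0 ?addr0 ?add0r; ring.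
exact: is_derive_cst.
Qed.

Lemma C2_data_opp {f f1 f2} : C2_data f f1 f2 ->
  C2_data (fun t => f (- t)) (fun t => - f1 (- t)) (fun t => f2 (- t)).
Proof.
move=> [F1 F2 F3].
have D g g1 t : (forall t, is_derive t (1 : R) g (g1 t)) ->
    is_derive t (1 : R) (fun t => g (- t)) (- g1 (- t)).
  move=> G.
  have := @is_derive1_comp R g -%R t (g1 (- t)) (-1) (G (- t)) _.
  by rewrite mulrN1; apply.
split=> t; first exact: D.
  have := D _ _ t F2 => h; have := is_deriveN h; rewrite opprK; exact.
apply: (@continuous_comp _ _ _ -%R f2); last exact: F3.
exact: opp_continuous.
Qed.

(** Source of the contact points at which the viscosity conditions are tested. *)
Lemma interior_max f (t1 t2 t3 : R) : t1 < t2 -> t2 < t3 ->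
  (forall t, t1 <= t <= t3 -> {for t, continuous f}) ->
  f t1 < f t2 -> f t3 < f t2 ->
  exists2 c, t1 < c < t3 & \forall t \near c, f t <= f c.
Proof.
move=> t12 t23 fc f12 f32.
have fc' : {within `[t1, t3], continuous f}.
  apply: continuous_in_subspaceT => t; rewrite inE /= in_itv /= => ht.
  exact: fc.
have [c] := EVT_max (ltW (lt_trans t12 t23)) fc'.
rewrite in_itv /= => /andP[c1 c3] fmax.
have c2 : f t2 <= f c by apply: fmax; rewrite in_itv /= !ltW.
have c1' : t1 < c.
  by rewrite lt_neqAle c1 andbT; apply/eqP => cE; rewrite -cE leNgt f12 in c2.
have c3' : c < t3.
  by rewrite lt_neqAle c3 andbT; apply/eqP => cE; rewrite cE leNgt f32 in c2.
exists c; first by rewrite c1' c3'.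
near=> t; apply: fmax; rewrite in_itv /= !ltW//.
  by near: t; exact: lt_nbhsl.
by near: t; exact: lt_nbhsr.
Unshelve. all: by end_near. Qed.

(** The map from [xi] to [u] reverses order, so test functions touching [u] from below become
    functions touching [xi] from above. Equality at [t0] is not imposed, since the conclusion only
    involves derivatives and [eta] may be shifted by a constant. *)
Definition super_ode (k : R) I xi := forall eta eta1 eta2 t0,
  C2_data eta eta1 eta2 -> I t0 ->
  (\forall t \near t0, xi t - eta t <= xi t0 - eta t0) ->
  `|eta1 t0| <= 1 /\ - k * (1 - eta1 t0 ^+ 2) <= eta2 t0.

(** Slopes of modulus at least [1] are unconstrained: there [d <= 0], and
    [(c, d, ..., d)] is outside the cone. *)
Definition sub_ode (k : R) I xi := forall eta eta1 eta2 t0,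
  C2_data eta eta1 eta2 -> I t0 ->
  (\forall t \near t0, xi t0 - eta t0 <= xi t - eta t) ->
  `|eta1 t0| < 1 -> eta2 t0 <= - k * (1 - eta1 t0 ^+ 2).

(** The condition is even in [eta1], hence invariant under reflection; this turns upper bounds for
    increments into lower bounds. *)
Lemma super_ode_opp k I xi : super_ode k I xi ->
  super_ode k [set t | I (- t)] (fun t => xi (- t)).
Proof.
move=> H eta eta1 eta2 t0 hC It0 near0.
have := H _ _ _ (- t0) (C2_data_opp hC) It0.
rewrite opprK normrN sqrrN; apply.
have := near0; rewrite -{1}[t0]opprK => h.
have hc : - t @[t --> (- t0)] --> - - t0 by exact: opp_continuous.
have h2 : \forall t \near - t0, (fun t => xi (- t) - eta t <= xi (- t0) - eta t0) (- t).
  exact: (hc _ h).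
by apply: (filterS _ h2) => t /=; rewrite !opprK.
Qed.

(** Describes an open interval without naming its end points, which may be infinite. The absence of
    extremal elements allows a step beyond any given point. *)
Record open_interval_like I : Prop := OpenIntervalLike {
  oil_conv : forall s t r, I s -> I t -> s <= r <= t -> I r;
  oil_left : forall t, I t -> exists2 s, s < t & I s;
  oil_right : forall t, I t -> exists2 s, t < s & I s }.

(** If the increment were larger, a line of slope greater than 1 plus an increasing exponential
    would touch [xi] from above between [t1] and a point [t3] beyond [t2], with slope above 1 at the
    contact point. *)
Lemma super_ode_increment k I xi : open_interval_like I ->
  (forall t, I t -> {for t, continuous xi}) -> super_ode k I xi ->
  forall t1 t2, I t1 -> I t2 -> t1 < t2 -> xi t2 - xi t1 <= t2 - t1.
Proof.
move=> HI xc Hs t1 t2 I1 I2 t12; rewrite leNgt; apply/negP => gap.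
have [t3 t23 I3] := oil_right HI I2.
pose L := t2 - t1; have L0 : 0 < L by rewrite subr_gt0.
pose d := xi t2 - xi t1 - L; have d0 : 0 < d by rewrite subr_gt0.
(* The mean slope of [xi] is [1 + d / L], and [s] lies halfway between it and 1. This leaves a
   margin [d / 2] between [t1] and [t2], of which [e] uses half. By [1 + x <= expR x], [M] is large
   enough for the exponential to absorb the variation of [xi] from [t2] to [t3]. *)
pose s := 1 + d / L / 2.
pose e := d / 4; have e0 : 0 < e by rewrite divr_gt0.
pose M := `|xi t3 - xi t2| / (e * (t3 - t2)).
have t32 : 0 < t3 - t2 by rewrite subr_gt0.
have M0 : 0 <= M by rewrite divr_ge0// mulr_ge0// ltW.
have s1 : 1 < s by rewrite /s ltrDl !divr_gt0.
have C := C2_dataD (C2_data_affine 0 s) (C2_data_exp e M t2).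
have [ec _] := C2_data_continuous C.
have It t : t1 <= t <= t3 -> I t by apply: (oil_conv HI).
have sL : s * (t2 - t1) = L + d / 2.
  rewrite -/L /s mulrDl mul1r; congr (_ + _).
  by rewrite mulrAC divfK// gt_eqF.
have := @interior_max (fun t => xi t - (0 + s * t + e * expR (M * (t - t2)))) t1 t2 t3 t12 t23.
case.
- move=> t ht; apply: cvgB; first by apply: xc; apply: It.
  exact: ec.
- rewrite subrr mulr0 expR0 mulr1.
  have : 0 < e * expR (M * (t1 - t2)) by rewrite mulr_gt0// expR_gt0.
  have : s * t2 = s * t1 + L + d / 2 by rewrite -addrA -sL; ring.
  by rewrite /e /d; lra.
- rewrite subrr mulr0 expR0 mulr1.
  have h : e * (1 + M * (t3 - t2)) <= e * expR (M * (t3 - t2)).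
    by rewrite ler_wpM2l ?expR_ge1Dx// ltW.
  have hM : e * (1 + M * (t3 - t2)) = e + `|xi t3 - xi t2|.
    rewrite mulrDr mulr1; congr (_ + _); rewrite /M; field.
    by rewrite !gt_eqF.
  have hs : s * t2 < s * t3 by rewrite ltr_pM2l// (lt_trans ltr01).
  have := ler_norm (xi t3 - xi t2).
  by rewrite hM in h; lra.
- move=> c /andP[c1 c3] near_c.
  have Ic : I c by apply: It; rewrite !ltW.
  have [+ _] := Hs _ _ _ c C Ic near_c.
  rewrite /= ger0_norm; last first.
    rewrite addr_ge0//; first by rewrite ltW// (lt_trans ltr01).
    by rewrite mulr_ge0 ?expR_ge0// mulr_ge0// ltW.
  have : 0 <= e * M * expR (M * (c - t2)) by rewrite mulr_ge0 ?expR_ge0// mulr_ge0// ltW.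
  by move: s1; lra.
Qed.

Lemma super_ode_lipschitz k I xi : open_interval_like I ->
  (forall t, I t -> {for t, continuous xi}) -> super_ode k I xi ->
  forall t1 t2, I t1 -> I t2 -> t1 < t2 -> `|xi t2 - xi t1| <= t2 - t1.
Proof.
move=> HI xc Hs t1 t2 I1 I2 t12; rewrite ler_norml; apply/andP; split; last first.
  exact: (super_ode_increment HI xc Hs).
have HI' : open_interval_like [set t | I (- t)].
  split=> /=.
  - move=> s t r Is It /andP[sr rt]; apply: (oil_conv HI It Is).
    by rewrite !lerN2 rt sr.
  - move=> t /(oil_right HI)[s ts Is]; exists (- s); last by rewrite opprK.
    by rewrite ltrNl.
  - move=> t /(oil_left HI)[s ts Is]; exists (- s); last by rewrite opprK.
    by rewrite ltrNr.
have xc' t : [set t | I (- t)] t -> {for t, continuous (fun t => xi (- t))}.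
  move=> It; apply: (@continuous_comp _ _ _ -%R xi); first exact: opp_continuous.
  exact: xc.
have := super_ode_increment HI' xc' (super_ode_opp Hs) (t1 := - t2) (t2 := - t1).
rewrite /= !opprK => /(_ I2 I1); rewrite ltrN2 => /(_ t12).
by lra.
Qed.

(** At an interior maximum of [xi - (eta - e * expR (M * (t - t2)))], the perturbed solution would
    be an admissible test function, although it strictly violates the inequality. *)
Lemma super_ode_le k I xi eta eta1 eta2 t1 t2 : open_interval_like I ->
  (forall t, I t -> {for t, continuous xi}) -> super_ode k I xi ->
  C2_data eta eta1 eta2 ->
  (forall t, eta2 t = - k * (1 - eta1 t ^+ 2)) -> (forall t, `|eta1 t| <= 1) ->
  I t1 -> I t2 -> xi t1 <= eta t1 -> xi t2 <= eta t2 ->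
  forall t, t1 <= t <= t2 -> xi t <= eta t.
Proof.
move=> HI xc Hs C ode e1 I1 I2 le1 le2 t /andP[t1t tt2].
rewrite leNgt; apply/negP => lt.
have {}t1t : t1 < t.
  by rewrite lt_neqAle t1t andbT; apply/eqP => tE; rewrite -tE ltNge le1 in lt.
have {}tt2 : t < t2.
  by rewrite lt_neqAle tt2 andbT; apply/eqP => tE; rewrite tE ltNge le2 in lt.
pose d := xi t - eta t; have d0 : 0 < d by rewrite subr_gt0.
pose K := `|k|; have K0 : 0 <= K by rewrite normr_ge0.
(* The defect of the perturbed solution is [e * M * p] times [M - 2 * (k * y) + k * e * M * p], with
   [p] in []0, 1]]. With [e * K <= 1/4] the last term is at least [- M / 4], and [3 * M / 4 > 2 * K]
   makes the bracket positive. The bound [e <= d / 2] keeps the perturbation from spoiling the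
   excess at [t]. *)
pose M := 4 * K + 1; have M0 : 0 < M by rewrite /M; lra.
pose e := Num.min (d / 2) ((4 * K + 1)^-1 / 4).
have e0 : 0 < e by rewrite lt_min !divr_gt0// invr_gt0.
have ed : e <= d / 2 by rewrite ge_min lexx.
have eK : e * K <= 4^-1.
  have : e <= (4 * K + 1)^-1 / 4 by rewrite ge_min lexx orbT.
  move=> /(ler_wpM2r K0) /le_trans; apply.
  rewrite mulrAC -[leRHS]mul1r ler_pM2r ?invr_gt0// mulrC ler_pdivrMr -/M//.
  by rewrite /M; lra.
have Cn := C2_dataD C (C2_data_exp (- e) M t2).
have [ec _] := C2_data_continuous Cn.
have It s : t1 <= s <= t2 -> I s by apply: (oil_conv HI).
have psi1 s : s <= t2 -> expR (M * (s - t2)) <= 1.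
  by move=> st; rewrite expR_le1 pmulr_rle0// subr_le0.
have := @interior_max (fun t => xi t - (eta t + (- e) * expR (M * (t - t2)))) t1 t t2 t1t tt2.
case.
- move=> s hs; apply: cvgB; first by apply: xc; apply: It.
  exact: ec.
- have := expR_gt0 (M * (t - t2)); have := psi1 t1 (ltW (lt_trans t1t tt2)).
  set x := expR (M * (t1 - t2)); set y := expR (M * (t - t2)).
  move=> x1 /(mulr_gt0 e0) y0.
  have : e * x <= e by rewrite ger_pMr.
  by move: ed le1; rewrite /d; lra.
- have := expR_gt0 (M * (t - t2)); have := psi1 t2 (lexx _).
  set x := expR (M * (t2 - t2)); set y := expR (M * (t - t2)).
  move=> x1 /(mulr_gt0 e0) y0.
  have : e * x <= e by rewrite ger_pMr.
  by move: ed le2; rewrite /d; lra.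
move=> c /andP[c1 c2] near_c.
have Ic : I c by apply: It; rewrite !ltW.
have [_] := Hs _ _ _ c Cn Ic near_c.
rewrite /= ode; have := psi1 c (ltW c2); have := expR_gt0 (M * (c - t2)).
move: (expR _) => p p0 p1; apply/negP; rewrite -ltNge -subr_gt0.
set y := eta1 c.
have -> : - k * (1 - (y + - e * M * p) ^+ 2)
       - (- k * (1 - y ^+ 2) + - e * M ^+ 2 * p)
   = e * M * p * (M - 2 * (k * y) + k * e * M * p) by ring.
apply: mulr_gt0; first by rewrite !mulr_gt0.
have h1 : k * y <= K.
  rewrite (le_trans (ler_norm _))// normrM ler_piMr//; exact: e1.
have h2 : - (M / 4) <= k * e * M * p.
  have : `|k * e * M * p| <= M / 4.
    rewrite !normrM -/K (gtr0_norm e0) (gtr0_norm M0) (gtr0_norm p0).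
    apply: (@le_trans _ _ (K * e * M)).
      by rewrite ler_piMr// !mulr_ge0// ltW.
    by rewrite mulrC ler_pM2l// mulrC.
  by rewrite ler_norml => /andP[].
by rewrite /M in h2 *; lra.
Qed.

(** Mirror image of [super_ode_le], with one extra constraint: [sub_ode] says something only about
    slopes of modulus less than 1, so the perturbed solution must keep such slopes. *)
Lemma sub_ode_ge k I xi eta eta1 eta2 t1 t2 : open_interval_like I ->
  (forall t, I t -> {for t, continuous xi}) -> sub_ode k I xi ->
  C2_data eta eta1 eta2 ->
  (forall t, eta2 t = - k * (1 - eta1 t ^+ 2)) -> (forall t, `|eta1 t| < 1) ->
  I t1 -> I t2 -> eta t1 <= xi t1 -> eta t2 <= xi t2 ->
  forall t, t1 <= t <= t2 -> eta t <= xi t.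
Proof.
move=> HI xc Hs C ode e1 I1 I2 le1 le2 t /andP[t1t tt2].
rewrite leNgt; apply/negP => lt.
have {}t1t : t1 < t.
  by rewrite lt_neqAle t1t andbT; apply/eqP => tE; rewrite -tE ltNge le1 in lt.
have {}tt2 : t < t2.
  by rewrite lt_neqAle tt2 andbT; apply/eqP => tE; rewrite tE ltNge le2 in lt.
pose d := eta t - xi t; have d0 : 0 < d by rewrite subr_gt0.
pose K := `|k|; have K0 : 0 <= K by rewrite normr_ge0.
pose M := 4 * K + 1; have M0 : 0 < M by rewrite /M; lra.
(* Compactness makes the strict slope bound uniform; the third term in the choice of [e] then limits
   the added slope to [r / 2]. *)
have [r r0 hr] : exists2 r, 0 < r & forall s, t1 <= s <= t2 -> `|eta1 s| <= 1 - r.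
  have [_ c1] := C2_data_continuous C.
  have cn : {within `[t1, t2], continuous (fun s => `|eta1 s|)}.
    apply: continuous_subspaceT => s.
    by apply: (@continuous_comp _ _ _ eta1); [exact: c1|exact: norm_continuous].
  have [c _ hc] := EVT_max (ltW (lt_trans t1t tt2)) cn.
  exists (1 - `|eta1 c|); first by rewrite subr_gt0.
  by move=> s hs; rewrite opprB addrC subrK; apply: hc; rewrite in_itv.
pose e := Num.min (Num.min (d / 2) ((4 * K + 1)^-1 / 4)) (r / M / 2).
have e0 : 0 < e by rewrite !lt_min !divr_gt0// invr_gt0.
have ed : e <= d / 2 by rewrite !ge_min lexx.
have er : e * M <= r / 2.
  have : e <= r / M / 2 by rewrite !ge_min lexx !orbT.
  by move=> /(ler_wpM2r (ltW M0)) /le_trans; apply; rewrite mulrAC divfK// gt_eqF.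
have eK : e * K <= 4^-1.
  have : e <= (4 * K + 1)^-1 / 4 by rewrite !ge_min lexx !orbT.
  move=> /(ler_wpM2r K0) /le_trans; apply.
  rewrite mulrAC -[leRHS]mul1r ler_pM2r ?invr_gt0// mulrC ler_pdivrMr -/M//.
  by rewrite /M; lra.
have Cn := C2_dataD C (C2_data_exp e M t2).
have [ec _] := C2_data_continuous Cn.
have It s : t1 <= s <= t2 -> I s by apply: (oil_conv HI).
have psi1 s : s <= t2 -> expR (M * (s - t2)) <= 1.
  by move=> st; rewrite expR_le1 pmulr_rle0// subr_le0.
have := @interior_max (fun t => eta t + e * expR (M * (t - t2)) - xi t) t1 t t2 t1t tt2.
case.
- move=> s hs; apply: cvgB; last by apply: xc; apply: It.
  exact: ec.
- have := expR_gt0 (M * (t - t2)); have := psi1 t1 (ltW (lt_trans t1t tt2)).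
  set x := expR (M * (t1 - t2)); set y := expR (M * (t - t2)).
  move=> x1 /(mulr_gt0 e0) y0.
  have : e * x <= e by rewrite ger_pMr.
  by move: ed le1; rewrite /d; lra.
- have := expR_gt0 (M * (t - t2)); have := psi1 t2 (lexx _).
  set x := expR (M * (t2 - t2)); set y := expR (M * (t - t2)).
  move=> x1 /(mulr_gt0 e0) y0.
  have : e * x <= e by rewrite ger_pMr.
  by move: ed le2; rewrite /d; lra.
move=> c /andP[c1 c2] near_c.
have Ic : I c by apply: It; rewrite !ltW.
have := Hs _ _ _ c Cn Ic.
have : `|eta1 c| <= 1 - r by apply: hr; rewrite !ltW.
rewrite /= ode; have := psi1 c (ltW c2); have := expR_gt0 (M * (c - t2)) => p0 p1.
set y := eta1 c; move=> yr.
have pM : e * M * expR (M * (c - t2)) <= r / 2.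
  by rewrite (le_trans _ er)// ler_piMr// mulr_ge0 ?ltW.
have lt1 : `|y + e * M * expR (M * (c - t2))| < 1.
  rewrite (le_lt_trans (ler_normD _ _))// [X in _ + X]ger0_norm; last first.
    by rewrite !mulr_ge0// ltW.
  by move: yr pM; lra.
have near_c' : \forall s \near c,
    xi c - (eta c + e * expR (M * (c - t2))) <= xi s - (eta s + e * expR (M * (s - t2))).
  by apply: filterS near_c => s /=; lra.
move=> /(_ near_c' lt1); move: p0 p1 {pM lt1 near_c near_c'}.
move: (expR _) => p p0 p1; apply/negP; rewrite -ltNge -subr_gt0.
have -> : - k * (1 - y ^+ 2) + e * M ^+ 2 * p
       - (- k * (1 - (y + e * M * p) ^+ 2))
   = e * M * p * (M - 2 * (k * y) - k * e * M * p) by ring.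
apply: mulr_gt0; first by rewrite !mulr_gt0.
have h1 : k * y <= K.
  rewrite (le_trans (ler_norm _))// normrM ler_piMr// ltW//; exact: e1.
have h2 : k * e * M * p <= (M / 4).
  have : `|k * e * M * p| <= M / 4.
    rewrite !normrM -/K (gtr0_norm e0) (gtr0_norm M0) (gtr0_norm p0).
    apply: (@le_trans _ _ (K * e * M)).
      by rewrite ler_piMr// !mulr_ge0// ltW.
    by rewrite mulrC ler_pM2l// mulrC.
  by rewrite ler_norml => /andP[].
by rewrite /M in h2 *; lra.
Qed.

End OneDimensional.

(** * Classification of the one-dimensional solutions *)

Section Classification.
Context {R : realType}.
Implicit Types (xi : R -> R) (s t k p q : R) (I : set R).

(** General solution of [h'' = k^2 h] for nonzero [k]. *)
Definition exp_comb k (c d t : R) : R := c * expR (- k * t) + d * expR (k * t).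

Lemma exp_comb_gt0 k (c d t : R) : 0 <= c -> 0 <= d -> 0 < c + d ->
  0 < exp_comb k c d t.
Proof.
move=> c0 d0 cd; have [c_gt0|c_le0] := ltP 0 c.
  by rewrite ltr_wpDr ?mulr_gt0 ?mulr_ge0 ?expR_gt0 ?expR_ge0.
have -> : c = 0 by apply/eqP; rewrite eq_le c0 c_le0.
rewrite /exp_comb mul0r add0r mulr_gt0 ?expR_gt0//.
by move: cd; lra.
Qed.

Lemma is_derive_exp_comb k (c d t : R) :
  is_derive t 1 (exp_comb k c d) (- k * exp_comb k c (- d) t).
Proof.
rewrite /exp_comb; apply: is_derive_eq.
by rewrite /GRing.scale /= ?scaler0 ?addr0 ?add0r; ring.
Qed.

Definition exp_slope k (c d t : R) := exp_comb k c (- d) t / exp_comb k c d t.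

(** Differentiation exchanges [exp_comb k c d] and [exp_comb k c (- d)] up to the factor [- k], so
    their quotient [w] satisfies the Riccati equation [w' = - k (1 - w^2)]. *)
Lemma C2_data_ln_exp_comb k (c d : R) : k != 0 -> 0 <= c -> 0 <= d -> 0 < c + d ->
  C2_data (fun t => - k^-1 * ln (exp_comb k c d t)) (exp_slope k c d)
          (fun t => - k * (1 - exp_slope k c d t ^+ 2)).
Proof.
move=> k0 c0 d0 cd; have h0 t := exp_comb_gt0 k t c0 d0 cd.
have hn t : exp_comb k c d t != 0 by rewrite gt_eqF.
have D2 t : is_derive t 1 (exp_slope k c d) (- k * (1 - exp_slope k c d t ^+ 2)).
  rewrite /exp_slope.
  have h1 := is_derive_exp_comb k c d t.
  have h2 := is_derive_exp_comb k c (- d) t.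
  have h3 := is_deriveM h2 (is_deriveV (hn t) h1).
  apply: (is_derive_eq h3).
  by rewrite opprK /GRing.scale /=; field.
split=> //.
- move=> t.
  have h1 := is_derive_exp_comb k c d t.
  have h2 := is_derive1_comp (is_derive1_ln (h0 t)) h1.
  have h3 := is_deriveZ (- k^-1) h2.
  apply: (is_derive_eq h3).
  by rewrite /exp_slope /GRing.scale /=; field; rewrite hn k0.
- move=> t; apply: cvgM; first exact: cvg_cst.
  apply: cvgB; first exact: cvg_cst.
  apply: (@continuous_comp _ _ _ (exp_slope k c d) (fun x => x ^+ 2)).
    exact: is_derive_continuous (D2 t).
  exact: exprn_continuous.
Qed.

Lemma exp_slope_le1 k (c d t : R) : 0 <= c -> 0 <= d -> 0 < c + d ->
  `|exp_slope k c d t| <= 1.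
Proof.
move=> c0 d0 cd; have h0 := exp_comb_gt0 k t c0 d0 cd.
rewrite normrM normfV (gtr0_norm h0) ler_pdivrMr// mul1r /exp_comb ler_norml.
have := mulr_ge0 c0 (expR_ge0 (- k * t)); have := mulr_ge0 d0 (expR_ge0 (k * t)).
by rewrite mulNr; lra.
Qed.

Lemma exp_slope_lt1 k (c d t : R) : 0 < c -> 0 < d -> `|exp_slope k c d t| < 1.
Proof.
move=> c0 d0; have h0 := exp_comb_gt0 k t (ltW c0) (ltW d0) (addr_gt0 c0 d0).
rewrite normrM normfV (gtr0_norm h0) ltr_pdivrMr// mul1r /exp_comb ltr_norml.
have := mulr_gt0 c0 (expR_gt0 (- k * t)); have := mulr_gt0 d0 (expR_gt0 (k * t)).
by rewrite mulNr; lra.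
Qed.

(** If a 1-Lipschitz function has the extremal increment over a segment, then it has it over every
    subsegment; [e] is the sign of the slope. *)
Lemma slope_one_between I xi p q : 
  (forall s t, I s -> I t -> s < t -> `|xi t - xi s| <= t - s) ->
  open_interval_like I -> I p -> I q ->
  forall e : R, `|e| = 1 -> p < q -> e * (xi q - xi p) = q - p ->
  forall t, p <= t <= q -> xi t = xi p + e * (t - p).
Proof.
move=> lip HI Ip Iq e e1 pq exi t /andP[pt tq].
have It : I t by apply: (oil_conv HI Ip Iq); rewrite pt.
have lip' a b : I a -> I b -> a <= b -> e * (xi b - xi a) <= b - a.
  move=> Ia Ib; rewrite le_eqVlt => /predU1P[->|ab]; first by rewrite !subrr mulr0.
  by rewrite (le_trans (ler_norm _))// normrM e1 mul1r lip.
have h1 := lip' _ _ Ip It pt; have h2 := lip' _ _ It Iq tq.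
have h3 : e * (xi t - xi p) = t - p.
  apply/eqP; rewrite eq_le h1 /=; move: exi h2; rewrite !mulrBr; lra.
have ee : e * e = 1 by rewrite -expr2 -real_normK ?num_real// e1 expr1n.
rewrite -h3 mulrA ee; ring.
Qed.

(** An extremal increment forces slope 1 or -1 and a single exponential. Otherwise [xi] is squeezed
    between the two comparison lemmas against the classical solution with the same end values. *)
Lemma exp_classification_local k I xi : k != 0 -> open_interval_like I ->
  (forall t, I t -> {for t, continuous xi}) -> super_ode k I xi -> sub_ode k I xi ->
  forall p q, I p -> I q -> p < q ->
  exists c d, [/\ 0 <= c, 0 <= d, 0 < c + d &
    forall t, p <= t <= q -> expR (- k * xi t) = exp_comb k c d t].
Proof.
move=> k0 HI xc Hs Hb p q Ip Iq pq.
have lip := super_ode_lipschitz HI xc Hs.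
have := lip _ _ Ip Iq pq; rewrite le_eqVlt => /predU1P[E|lt].
  have [xx|xx] := leP 0 (xi q - xi p).
    have h := slope_one_between lip HI Ip Iq (e := 1) (normr1 _) pq.
    exists (expR (- k * (xi p - p))), 0; split; rewrite ?addr0 ?expR_gt0 ?expR_ge0//.
    move=> t tpq; rewrite h ?mul1r//; last by rewrite -E ger0_norm.
    by rewrite /exp_comb mul0r addr0 -expRD; congr expR; ring.
  have h := slope_one_between lip HI Ip Iq (e := -1) (normrN1 _) pq.
  exists 0, (expR (- k * (xi p + p))); split; rewrite ?add0r ?expR_gt0 ?expR_ge0//.
  move=> t tpq; rewrite h ?mulN1r//; last by rewrite -E ltr0_norm.
  by rewrite /exp_comb mul0r add0r -expRD; congr expR; ring.
(* Cramer's rule for the coefficients such that [exp_comb k c d] equals [expR (- k * xi)] at [p] and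
   at [q]; [D] is the determinant. *)
pose D := expR (k * (q - p)) - expR (- k * (q - p)).
pose c := (expR (- k * xi p + k * q) - expR (- k * xi q + k * p)) / D.
pose d := (expR (- k * xi q - k * p) - expR (- k * xi p - k * q)) / D.
have [lt1 lt2] : xi p - xi q < q - p /\ xi q - xi p < q - p.
  by move: lt; rewrite ltr_norml; lra.
(* Both numerators have the sign of [k], like [D], precisely because the increment of [xi] is not
   extremal. Positivity of both coefficients yields the strict slope bound required by
   [sub_ode_ge]. *)
have [c0 d0 D0] : [/\ 0 < c, 0 < d & D != 0].
  have [kn|kp|] := ltgtP k 0; last by move/eqP; rewrite (negPf k0).
    have Dn : D < 0.
      have : k * (q - p) < 0 by rewrite nmulr_rlt0// subr_gt0.
      by rewrite subr_lt0 ltr_expR mulNr; lra.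
    rewrite /c /d !nmulr_lgt0 ?invr_lt0 ?lt_eqF// !subr_lt0 !ltr_expR; split=> //.
      rewrite -(ltr_nM2l kn) in lt1; move: lt1; rewrite !mulrBr; lra.
    rewrite -(ltr_nM2l kn) in lt2; move: lt2; rewrite !mulrBr; lra.
  have Dp : 0 < D.
    have : 0 < k * (q - p) by rewrite mulr_gt0// subr_gt0.
    by rewrite subr_gt0 ltr_expR mulNr; lra.
  rewrite /c /d !pmulr_lgt0 ?invr_gt0 ?gt_eqF// !subr_gt0 !ltr_expR; split=> //.
    rewrite -(ltr_pM2l kp) in lt1; move: lt1; rewrite !mulrBr; lra.
  rewrite -(ltr_pM2l kp) in lt2; move: lt2; rewrite !mulrBr; lra.
have DE : D = expR (k * q) / expR (k * p) - expR (k * p) / expR (k * q).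
  by rewrite /D -!expRB; congr (expR _ - expR _); ring.
have aux x y e f : (x / D * e + y / D * f) * D = x * e + y * f by field.
have hp : exp_comb k c d p = expR (- k * xi p).
  apply: (mulIf D0); rewrite /exp_comb /c /d aux DE.
  rewrite !mulNr !expRD !expRN; field.
  by rewrite !gt_eqF ?expR_gt0.
have hq : exp_comb k c d q = expR (- k * xi q).
  apply: (mulIf D0); rewrite /exp_comb /c /d aux DE.
  rewrite !mulNr !expRD !expRN; field.
  by rewrite !gt_eqF ?expR_gt0.
exists c, d; split; rewrite ?addr_gt0 ?ltW// => t tpq.
have h0 s := exp_comb_gt0 k s (ltW c0) (ltW d0) (addr_gt0 c0 d0).
pose eta t := - k^-1 * ln (exp_comb k c d t).
have etaE s x : exp_comb k c d s = expR (- k * x) -> eta s = x.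
  by move=> e; rewrite /eta e expRK; field.
have C := C2_data_ln_exp_comb k0 (ltW c0) (ltW d0) (addr_gt0 c0 d0).
have E : xi t = eta t.
  apply/eqP; rewrite eq_le; apply/andP; split.
    apply: (super_ode_le HI xc Hs C _ _ Ip Iq) tpq => //.
    - by move=> s; apply/exp_slope_le1; rewrite ?addr_gt0 ?ltW.
    - by rewrite -/(eta p) (etaE _ _ hp).
    - by rewrite -/(eta q) (etaE _ _ hq).
  apply: (sub_ode_ge HI xc Hb C _ _ Ip Iq) tpq => //.
  - by move=> s; exact/exp_slope_lt1.
  - by rewrite -/(eta p) (etaE _ _ hp).
  - by rewrite -/(eta q) (etaE _ _ hq).
by rewrite E /eta mulrA mulrNN divff// mul1r lnK ?posrE.
Qed.

(** Lets the representations found on overlapping segments be glued. *)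
Lemma exp_comb_inj k (c d c' d' p q : R) : k != 0 -> p < q ->
  exp_comb k c d p = exp_comb k c' d' p -> exp_comb k c d q = exp_comb k c' d' q ->
  c = c' /\ d = d'.
Proof.
move=> k0 pq; rewrite /exp_comb !mulNr !expRN.
set P := expR (k * p); set Q := expR (k * q) => hp hq.
have P0 : 0 < P by exact: expR_gt0. have Q0 : 0 < Q by exact: expR_gt0.
have PQ : P ^+ 2 - Q ^+ 2 != 0.
  rewrite subr_sqr mulf_neq0//; last by rewrite gt_eqF ?addr_gt0.
  rewrite subr_eq0; apply/eqP => /expR_inj /(mulfI k0) E.
  by rewrite E ltxx in pq.
have hp' : (c - c') + (d - d') * P ^+ 2 = 0.
  have /eqP := hp; rewrite -subr_eq0 => /eqP h.
  rewrite -[RHS](mulr0 P) -h; field; exact: lt0r_neq0.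
have hq' : (c - c') + (d - d') * Q ^+ 2 = 0.
  have /eqP := hq; rewrite -subr_eq0 => /eqP h.
  rewrite -[RHS](mulr0 Q) -h; field; exact: lt0r_neq0.
have dd : d - d' = 0.
  apply: (mulIf PQ); rewrite mul0r mulrBr; move: hp' hq'; lra.
by rewrite dd mul0r addr0 in hp'; split; apply/eqP; rewrite -subr_eq0 ?hp' ?dd.
Qed.

Lemma exp_classification k I xi : k != 0 -> open_interval_like I -> I !=set0 ->
  (forall t, I t -> {for t, continuous xi}) -> super_ode k I xi -> sub_ode k I xi ->
  exists c d, [/\ 0 <= c, 0 <= d, 0 < c + d &
    forall t, I t -> expR (- k * xi t) = exp_comb k c d t].
Proof.
move=> k0 HI [p Ip] xc Hs Hb; have [q pq Iq] := oil_right HI Ip.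
have loc := exp_classification_local k0 HI xc Hs Hb.
have [c [d [c0 d0 cd h]]] := loc _ _ Ip Iq pq.
exists c, d; split=> // t It.
(* The segment from [a] to [b] contains [p], [q] and [t]; its representation agrees with the first
   one at [p] and [q], so the coefficients coincide. *)
pose a := Num.min p t; pose b := Num.max q t.
have Ia : I a by rewrite /a; case: leP.
have Ib : I b by rewrite /b; case: leP.
have ap : a <= p by rewrite ge_min lexx.
have qb : q <= b by rewrite le_max lexx.
have ab : a < b by rewrite (le_lt_trans ap)// (lt_le_trans pq).
have [c' [d' [_ _ _ h']]] := loc _ _ Ia Ib ab.
have [] := @exp_comb_inj k c d c' d' p q k0 pq.
- by rewrite -h ?lexx ?ltW// -h'// ap ltW// (lt_le_trans pq).
- by rewrite -h ?lexx ?ltW// -h'// qb ltW// (le_lt_trans ap).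
- by move=> -> ->; apply: h'; rewrite ge_min le_max lexx !orbT.
Qed.

(** For [k = 0] the classical solutions are affine, so the comparison is made with the chord; the
    local chords are glued as in the exponential case. *)
Lemma affine_classification I xi : open_interval_like I -> I !=set0 ->
  (forall t, I t -> {for t, continuous xi}) -> super_ode 0 I xi -> sub_ode 0 I xi ->
  exists c d, `|d| <= 1 /\ forall t, I t -> xi t = c + d * t.
Proof.
move=> HI [p Ip] xc Hs Hb; have [q pq Iq] := oil_right HI Ip.
have lip := super_ode_lipschitz HI xc Hs.
have loc a b : I a -> I b -> a < b -> exists c d, `|d| <= 1 /\
    forall t, a <= t <= b -> xi t = c + d * t.
  move=> Ia Ib ab; have ba : 0 < b - a by rewrite subr_gt0.
  pose d := (xi b - xi a) / (b - a); pose c := xi a - d * a.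
  have cb : c + d * b = xi b by rewrite /c /d; field; rewrite gt_eqF.
  have ca : c + d * a = xi a by rewrite /c; ring.
  exists c, d.
  have := lip _ _ Ia Ib ab; rewrite le_eqVlt => /predU1P[E|lt].
    split; first by rewrite /d normrM normfV E (gtr0_norm ba) divff ?gt_eqF.
    move=> t tab.
    have [xx|xx] := leP 0 (xi b - xi a).
      have d1 : d = 1 by rewrite /d -(ger0_norm xx) E divff ?gt_eqF.
      rewrite (slope_one_between lip HI Ia Ib (e := 1) (normr1 _) ab _ tab).
        by rewrite /c d1; ring.
      by rewrite mul1r -E ger0_norm.
    have d1 : d = -1 by rewrite /d -[_ - _ in X in X / _]opprK -(ltr0_norm xx) E mulNr divff ?gt_eqF.
    rewrite (slope_one_between lip HI Ia Ib (e := -1) (normrN1 _) ab _ tab).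
      by rewrite /c d1; ring.
    by rewrite mulN1r -E ltr0_norm.
  have d1 : `|d| < 1.
    by rewrite /d normrM normfV (gtr0_norm ba) ltr_pdivrMr// mul1r.
  split; first exact: ltW.
  move=> t tab; apply/eqP; rewrite eq_le; apply/andP; split.
    apply: (super_ode_le HI xc Hs (C2_data_affine c d) _ _ Ia Ib _ _ tab).
    - by move=> s; rewrite oppr0 mul0r.
    - by move=> s; exact: ltW.
    - by rewrite ca.
    - by rewrite cb.
  apply: (sub_ode_ge HI xc Hb (C2_data_affine c d) _ _ Ia Ib _ _ tab).
  - by move=> s; rewrite oppr0 mul0r.
  - by [].
  - by rewrite ca.
  - by rewrite cb.
have [c [d [d1 h]]] := loc _ _ Ip Iq pq.
exists c, d; split=> // t It.
pose a := Num.min p t; pose b := Num.max q t.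
have Ia : I a by rewrite /a; case: leP.
have Ib : I b by rewrite /b; case: leP.
have ap : a <= p by rewrite ge_min lexx.
have qb : q <= b by rewrite le_max lexx.
have ab : a < b by rewrite (le_lt_trans ap)// (lt_le_trans pq).
have [c' [d' [_ h']]] := loc _ _ Ia Ib ab.
have hp : c + d * p = c' + d' * p.
  by rewrite -h ?lexx ?ltW// -h'// ap ltW// (lt_le_trans pq).
have hq : c + d * q = c' + d' * q.
  by rewrite -h ?lexx ?ltW// -h'// qb ltW// (le_lt_trans ap).
have dd : d = d'.
  have : (d - d') * (q - p) = 0 by move: hp hq; lra.
  move=> /eqP; rewrite mulf_eq0 !subr_eq0 => /orP[/eqP//|/eqP qp].
  by rewrite qp ltxx in pq.
have cc : c = c' by move: hp; rewrite dd => /addIr.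
by rewrite cc dd; apply: h'; rewrite ge_min le_max lexx !orbT.
Qed.

End Classification.

(** * Spectral theorem for real symmetric matrices *)

Lemma char_poly_invmx_conj (F : fieldType) n (P D : 'M[F]_n) : P \in unitmx ->
  char_poly (invmx P *m D *m P) = char_poly D.
Proof.
move=> Pu; pose p := map_mx (@polyC F).
have pVP : p _ _ (invmx P) *m p _ _ P = 1%:M by rewrite -map_mxM mulVmx// map_mx1.
rewrite /char_poly /char_poly_mx.
have -> : 'X%:M - map_mx polyC (invmx P *m D *m P) =
    p _ _ (invmx P) *m ('X%:M - p _ _ D) *m p _ _ P.
  rewrite mulmxBr mulmxBl scalar_mxC -[_%:M *m _ *m _]mulmxA pVP mulmx1; congr (_ - _).
  by rewrite /p !map_mxM.
rewrite !det_mulmx mulrAC -det_mulmx pVP det1 mul1r.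
by [].
Qed.

Section Spectral.
Context {R : realType} {n : nat}.
Implicit Types (A : 'M[R]_n) (v : 'rV[R]_n) (i j : 'I_n).

Definition quad_form A v : R := \sum_i \sum_j v 0 i * A i j * v 0 j.

Definition dot (v w : 'rV[R]_n) : R := \sum_i v 0 i * w 0 i.

Local Notation toC := (real_complex R).
Local Notation C := (R[i]).

Lemma Re_sum (I : finType) (F : I -> C) :
  complex.Re (\sum_i F i) = \sum_i complex.Re (F i).
Proof. by apply: (big_morph (@complex.Re R)) => // -[a b] [c d]. Qed.

(** [X] and [Y] are the real and imaginary parts of a unitary matrix
    diagonalizing [A], which avoids making that matrix real. *)
Lemma spectral_real A : A^T = A -> exists (l : 'rV[R]_n) (X Y : 'M[R]_n),
  [/\ eigenvalue_vector A l,
      forall i, l 0 i = quad_form A (row i X) + quad_form A (row i Y),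
      forall i, dot (row i X) (row i X) + dot (row i Y) (row i Y) = 1,
      forall v, \sum_i (dot (row i X) v ^+ 2 + dot (row i Y) v ^+ 2) = dot v v
    & forall v, \sum_i l 0 i * (dot (row i X) v ^+ 2 + dot (row i Y) v ^+ 2)
        = quad_form A v].
Proof.
move=> Asym; pose AC := map_mx toC A.
have ACr : AC \is a mxOver Num.real.
  by apply/mxOverP => i j; rewrite mxE; apply/complex_realP; exists (A i j).
have ACs : AC \is symmetricmx.
  apply/is_hermitianmxP; rewrite expr0 scale1r; apply/matrixP => i j.
  by rewrite !mxE -[in LHS]Asym mxE.
(* A real symmetric matrix is Hermitian over the complex numbers, so it is unitarily diagonalizable
   there with real eigenvalues. *)
have ACh := realsym_hermsym ACs ACr.
have /orthomx_spectralP ACE := hermitian_normalmx ACh.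
have Dr := hermitian_spectral_diag_real ACh.
have Pu := spectral_unitarymx AC.
move: ACE Dr Pu; set P := spectralmx AC; set D := spectral_diag AC => ACE Dr Pu.
have Pinv := invmx_unitary Pu.
have Punit := unitarymx_unit Pu.
pose l : 'rV[R]_n := map_mx (@complex.Re R) D.
have lD i : toC (l 0 i) = D 0 i.
  by rewrite mxE RRe_real// (mxOverP Dr).
pose X : 'M[R]_n := map_mx (@complex.Re R) P.
pose Y : 'M[R]_n := map_mx (@complex.Im R) P.
have Re_term (z w : C) (a : R) : complex.Re (z * toC a * (w^*)%R)
    = complex.Re z * a * complex.Re w + complex.Im z * a * complex.Im w.
  by case: z => z1 z2; case: w => w1 w2 /=; ring.
have rowq (M : 'M[R]_n) i : complex.Re ((P *m map_mx toC M *m P ^t*)%sesqui i i)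
   = quad_form M (row i X) + quad_form M (row i Y).
  rewrite mxE Re_sum /quad_form -big_split /=.
  under [RHS]eq_bigr do rewrite -big_split /=.
  rewrite exchange_big /=.
  apply: eq_bigr => k _; rewrite mxE mulr_suml Re_sum; apply: eq_bigr => j _.
  by rewrite !mxE Re_term.
have zE v i : (map_mx toC v *m P^T) 0 i = Complex (dot (row i X) v) (dot (row i Y) v).
  apply/eqP; rewrite eq_complex /=; apply/andP; split; apply/eqP.
    rewrite mxE Re_sum; apply: eq_bigr => j _; rewrite !mxE.
    by case: (P i j) => p1 p2 /=; ring.
  rewrite mxE (big_morph (@complex.Im R) (id1 := 0) (op1 := +%R)) => [||//]; last first.
    by move=> -[a b] [c d].
  apply: eq_bigr => j _; rewrite !mxE.
  by case: (P i j) => p1 p2 /=; ring.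
(* Evaluates a diagonal form at the coordinates of [v] in the basis [P]. Taking [d] constant equal
   to 1 gives Parseval's identity, and [d = l] gives the diagonalization of the quadratic form. *)
have cdiag v (d : 'rV[R]_n) :
    complex.Re ((map_mx toC v *m P^T *m diag_mx (map_mx toC d)
       *m (map_mx toC v *m P^T) ^t*)%sesqui 0 0)
     = \sum_i d 0 i * (dot (row i X) v ^+ 2 + dot (row i Y) v ^+ 2).
  rewrite mxE Re_sum; apply: eq_bigr => i _.
  rewrite mul_mx_diag !mxE.
  have := zE v i; rewrite mxE => ->.
  by rewrite /=; ring.
have PTP : P^T *m (P^T ^t*)%sesqui = 1%:M by apply/unitarymxP; rewrite trmx_unitary.
exists l, X, Y; split.
- apply: (map_poly_inj toC); rewrite map_char_poly -/AC ACE.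
  rewrite char_poly_invmx_conj// char_poly_trig ?diag_mx_is_trig//.
  rewrite rmorph_prod; apply: eq_bigr => i _ /=.
  by rewrite rmorphB /= map_polyX map_polyC /= lD mxE eqxx mulr1n.
- move=> i; rewrite -rowq -/AC ACE Pinv !mulmxA -(mulmxA _ P) (unitarymxP Pu) mulmx1.
  by rewrite mul1mx [in RHS]mxE eqxx mulr1n -lD.
- move=> i; have := rowq 1%:M i.
  rewrite map_mx1 mulmx1 (unitarymxP Pu) mxE eqxx /= => ->.
  have q1 v : quad_form 1%:M v = dot v v.
    apply: eq_bigr => j _; rewrite (bigD1 j)//= big1 ?addr0 ?mxE ?eqxx ?mulr1//.
    by move=> k /negPf jk; rewrite mxE eq_sym jk mulr0 mul0r.
  by rewrite !q1.
- move=> v; have := cdiag v (const_mx 1).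
  rewrite map_const_mx diag_const_mx mulmx1 trmx_mul map_mxM mulmxA.
  rewrite -(mulmxA _ P^T) PTP mulmx1.
  under [RHS]eq_bigr do rewrite mxE mul1r.
  move=> <-; rewrite mxE Re_sum; apply: eq_bigr => i _.
  by rewrite !mxE /=; ring.
- move=> v; rewrite -cdiag; have -> : map_mx toC l = D.
    by apply/matrixP => i j; rewrite ord1 mxE lD.
  rewrite trmx_mul map_mxM trmxK mulmxA.
  have -> : map_mx toC v *m P^T *m diag_mx D *m map_mx Num.conj P = map_mx toC v *m AC.
    have ACT : AC^T = AC by apply/matrixP => i j; rewrite !mxE -[in RHS]Asym mxE.
    by rewrite -ACT ACE Pinv !trmx_mul map_trmx trmxK tr_diag_mx !mulmxA.
  rewrite mxE Re_sum /quad_form exchange_big /=; apply: eq_bigr => j _.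
  rewrite !mxE mulr_suml Re_sum; apply: eq_bigr => i _.
  by rewrite !mxE /=; ring.
Qed.

End Spectral.

(** * Symmetric convex cones *)

Record admissible {R : realType} {n : nat} (Gamma : set 'rV[R]_n) : Prop := Admissible {
  adm_open : open Gamma;
  adm_convex : convex_set Gamma;
  adm_sym : is_symmetric Gamma;
  adm_cone : is_cone Gamma;
  adm_lower : positive_cone `<=` Gamma;
  adm_upper : Gamma `<=` positive_trace }.


Section Cones.
Context {R : realType} {n : nat} {Gamma : set 'rV[R]_n}.
Context (adm : admissible Gamma).
Implicit Types (x y z l : 'rV[R]_n) (e : R).

Definition nonneg x := forall i, 0 <= x 0 i.

(** The sum is twice the midpoint. *)
Lemma coneD x y : Gamma x -> Gamma y -> Gamma (x + y).
Proof.
move=> gx gy; have h0 : 0 <= (2^-1 : R) by rewrite invr_ge0.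
have h1 : (2^-1 : R) <= 1 by rewrite invf_le1 ?ler1n.
have := adm_convex adm (x := x) (y := y) (Itv01 h0 h1).
rewrite !inE => /(_ gx gy) /(adm_cone adm (ltr0n _ 2)).
rewrite /conv /= scalerDr !scalerA.
have -> : 2 * (1 - 2^-1) = 1 :> R by field.
by rewrite divff// !scale1r.
Qed.

(** Approximate [x] by an element of the cone and absorb the small error into [y], which is an
    interior point. *)
Lemma closure_coneD x y : closure Gamma x -> Gamma y -> Gamma (x + y).
Proof.
move=> cx gy; have := adm_open adm; rewrite openE => /(_ _ gy) /nbhs_ballP[e /= e0 he].
have [z [gz xz]] := cx _ (nbhsx_ballx x e e0).
have -> : x + y = z + (y + (x - z)).
  by rewrite addrCA [z + _]addrC subrK addrC.
apply: coneD => //; apply: he; case: xz => _ xz; split=> // i j.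
have := xz i j; rewrite -!ball_normE /= !mxE => h.
by rewrite opprD addNKr opprB distrC.
Qed.

Lemma coneD_nonneg x y : Gamma x -> nonneg y -> Gamma (x + y).
Proof.
move=> gx y0; have := adm_open adm; rewrite openE => /(_ _ gx) /nbhs_ballP[e /= e0 he].
have -> : x + y = (x - const_mx (e / 2)) + (y + const_mx (e / 2)).
  by rewrite addrACA [- _ + _]addrC subrr addr0.
apply: coneD; last first.
  by apply: (adm_lower adm) => i; rewrite !mxE ltr_wpDl// divr_gt0.
apply: he; split=> // i j; rewrite -ball_normE /= !mxE opprB addrC subrK.
by rewrite gtr0_norm ?divr_gt0// ltr_pdivrMr// ltr_pMr// ltr1n.
Qed.

Lemma cone_shrink x : Gamma x -> exists2 e, 0 < e & Gamma (x - const_mx e).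
Proof.
move=> gx; have := adm_open adm; rewrite openE => /(_ _ gx) /nbhs_ballP[e /= e0 he].
exists (e / 2); first by rewrite divr_gt0.
apply: he; split=> // i j; rewrite -ball_normE /= !mxE opprB addrC subrK.
by rewrite gtr0_norm ?divr_gt0// ltr_pdivrMr// ltr_pMr// ltr1n.
Qed.

Lemma cone_const e : 0 < e -> Gamma (const_mx e).
Proof. by move=> e0; apply: (adm_lower adm) => i; rewrite mxE. Qed.

(** Reduces statements about the closure to the open cone, where sums and domination are
    available. *)
Lemma closure_coneP x :
  closure Gamma x <-> forall e, 0 < e -> Gamma (x + const_mx e).
Proof.
split=> [cx e e0|h]; first exact/closure_coneD/cone_const.
move=> B /nbhs_ballP[e /= e0 he]; exists (x + const_mx (e / 2)); split.
  by apply: h; rewrite divr_gt0.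
apply: he; split=> // i j; rewrite -ball_normE /= !mxE opprD addNKr normrN.
by rewrite gtr0_norm ?divr_gt0// ltr_pdivrMr// ltr_pMr// ltr1n.
Qed.

Lemma cone_sum (I : finType) (P : pred I) (w : I -> R) (g : I -> 'rV[R]_n) :
  (forall i, P i -> 0 <= w i) -> 0 < \sum_(i | P i) w i ->
  (forall i, P i -> Gamma (g i)) -> Gamma (\sum_(i | P i) w i *: g i).
Proof.
move=> w0 sw gG.
suff [//|h] : Gamma (\sum_(i | P i) w i *: g i) \/ \sum_(i | P i) w i = 0.
  by rewrite h ltxx in sw.
(* Partial sums whose weights all vanish give the zero vector, which is not in the cone; the
   induction must carry this alternative along. *)
have : (0 <= \sum_(i | P i) w i) /\ (Gamma (\sum_(i | P i) w i *: g i) \/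
    (\sum_(i | P i) w i = 0 /\ \sum_(i | P i) w i *: g i = 0)).
  elim/big_ind2 : _ => [|a x b y [a0 hx] [b0 hy]|i Pi].
  - by split=> //; right.
  - split; first exact: addr_ge0.
    case: hx hy => [gx|[-> ->]] [gy|[-> ->]].
    + by left; apply: coneD.
    + by left; rewrite addr0.
    + by left; rewrite add0r.
    + by right; rewrite !addr0.
  - split; first exact: w0.
    have := w0 _ Pi; rewrite le_eqVlt => /predU1P[<-|wi].
      by right; rewrite scale0r.
    by left; apply: (adm_cone adm) => //; exact: gG.
by case=> _ [|[]]; [left|right].
Qed.

Lemma cone_vec_mono (c d c' d' : R) : c <= c' -> d <= d' ->
  Gamma (vec_head_tail c d) -> Gamma (vec_head_tail c' d').
Proof.
move=> cc dd g.
have -> : vec_head_tail c' d' = vec_head_tail c d + vec_head_tail (c' - c) (d' - d) :> 'rV[R]_n.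
  by apply/rowP => i; rewrite !mxE; case: ifP => _; ring.
by apply: coneD_nonneg => // i; rewrite mxE; case: ifP; rewrite subr_ge0.
Qed.

Lemma closure_vecP (c d : R) : closure Gamma (vec_head_tail c d) <->
  forall e, 0 < e -> Gamma (vec_head_tail (c + e) (d + e)).
Proof.
have E e : vec_head_tail c d + const_mx e = vec_head_tail (c + e) (d + e) :> 'rV[R]_n.
  by apply/rowP => i; rewrite !mxE; case: ifP.
by rewrite closure_coneP; split=> h e /h; rewrite E.
Qed.

Lemma vec_head_tailZ (t c d : R) :
  t *: vec_head_tail c d = vec_head_tail (t * c) (t * d) :> 'rV[R]_n.
Proof. by apply/rowP => i; rewrite !mxE; case: ifP. Qed.

Lemma boundaryP x : boundary Gamma x <-> closure Gamma x /\ ~ Gamma x.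
Proof.
rewrite /boundary /=; split=> -[cx nx]; split=> //.
- by have := adm_open adm; rewrite interior_id => E; rewrite E in nx.
- by have := adm_open adm; rewrite interior_id => ->.
Qed.

(** * Vectors (c, d, ..., d) in the cone and in its closure *)

Section Mu.
Context (mu : R) (n_ge3 : (3 <= n)%N).
Context (mu_ge0 : 0 <= mu).
Context (mu_bd : boundary Gamma (vec_head_tail (- mu) 1)).
Context (e1_bd : boundary Gamma (vec_head_tail 1 0)).

(** If either inequality failed, adding a positive vector would produce a positive multiple of (1,
    0, ..., 0), respectively of (-mu, 1, ..., 1), inside the open cone, while both vectors are
    boundary points. *)
Lemma closure_vec_mu (c d : R) : closure Gamma (vec_head_tail c d) ->
  0 <= d /\ - mu * d <= c.
Proof.
move=> cl.
have [_ ne1] := (boundaryP _).1 e1_bd; have [_ nmu] := (boundaryP _).1 mu_bd.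
have add s r : 0 < s -> 0 < r -> Gamma (vec_head_tail (c + s) (d + r)).
  move=> s0 r0; have -> : vec_head_tail (c + s) (d + r) =
    vec_head_tail c d + vec_head_tail s r :> 'rV[R]_n.
    by apply/rowP => i; rewrite !mxE; case: ifP.
  apply: closure_coneD => //; apply: (adm_lower adm) => i.
  by rewrite mxE; case: ifP.
have d0 : 0 <= d.
  rewrite leNgt; apply/negP => d0; apply: ne1.
  have := add (`|c| + 1) (- d); rewrite oppr_gt0 d0 subrr.
  have p : 0 < c + (`|c| + 1) by have := ler_norm (- c); rewrite normrN; lra.
  rewrite ltr_wpDl// => /(_ isT isT).
  have p' : 0 < (c + (`|c| + 1))^-1 by rewrite invr_gt0.
  by move=> /(adm_cone adm p'); rewrite vec_head_tailZ mulr0 mulVf ?gt_eqF.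
split=> //; rewrite leNgt; apply/negP => lt; apply: nmu.
pose g := - mu * d - c; have g0 : 0 < g by rewrite subr_gt0.
(* Small enough that [mu * r < g]: after raising the tail to [d + r], the head still has to be
   raised to reach [- mu * (d + r)]. *)
pose r := g / (2 * (mu + 1)).
have m1 : 0 < mu + 1 by rewrite ltr_wpDl.
have r0 : 0 < r by rewrite divr_gt0// mulr_gt0.
have mr : mu * r < g.
  rewrite /r mulrA ltr_pdivrMr ?mulr_gt0// mulrC ltr_pM2l//.
  by move: mu_ge0; lra.
have := add (- mu * (d + r) - c) r.
rewrite (addrC c) subrK => /(_ _ r0) h.
have {}h : Gamma (vec_head_tail (- mu * (d + r)) (d + r)).
  by apply: h; move: mr; rewrite /g; lra.
have p : 0 < (d + r)^-1 by rewrite invr_gt0 ltr_wpDl.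
move: h => /(adm_cone adm p); rewrite vec_head_tailZ mulVf.
  by rewrite mulrCA mulVf ?mulr1// gt_eqF// ltr_wpDl.
by rewrite gt_eqF// ltr_wpDl.
Qed.

(** The strict inequalities leave room to split off a positive vector from a positive multiple of
    the boundary vector (-mu, 1, ..., 1). *)
Lemma cone_vec_mu (c d : R) : 0 < d -> - mu * d < c ->
  Gamma (vec_head_tail c d).
Proof.
move=> d0 lt; pose g := c + mu * d; have g0 : 0 < g by rewrite /g; lra.
have m1 : 0 < mu + 1 by rewrite ltr_wpDl.
pose e := Num.min (d / 2) (g / (2 * (mu + 1))).
have e0 : 0 < e by rewrite lt_min !divr_gt0// mulr_gt0.
have ed : e <= d / 2 by rewrite ge_min lexx.
have eg : mu * e < g.
  have : e <= g / (2 * (mu + 1)) by rewrite ge_min lexx orbT.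
  move=> /(ler_wpM2l mu_ge0) /le_lt_trans; apply.
  rewrite mulrA ltr_pdivrMr ?mulr_gt0// mulrC ltr_pM2l//.
  by move: mu_ge0; lra.
have [cmu _] := (boundaryP _).1 mu_bd.
have t0 : 0 < d - e by move: ed; lra.
have -> : vec_head_tail c d =
    (d - e) *: vec_head_tail (- mu) 1 + vec_head_tail (g - mu * e) e :> 'rV[R]_n.
  by rewrite vec_head_tailZ; apply/rowP => i; rewrite !mxE /g; case: ifP => _; ring.
apply: closure_coneD; last first.
  by apply: (adm_lower adm) => i; rewrite mxE; case: ifP; rewrite ?subr_gt0.
apply/closure_coneP => r r0.
have -> : const_mx r = (d - e) *: const_mx (r / (d - e)) :> 'rV[R]_n.
  by apply/rowP => i; rewrite !mxE mulrC divfK// gt_eqF.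
rewrite -scalerDr; apply: (adm_cone adm) => //.
by apply/closure_coneD => //; apply: cone_const; rewrite divr_gt0.
Qed.

Lemma closure_vec_muE (d : R) : 0 <= d -> closure Gamma (vec_head_tail (- mu * d) d).
Proof.
have [cmu _] := (boundaryP _).1 mu_bd.
move=> d0; apply/closure_vecP => e e0.
have de : 0 < d + e by rewrite ltr_wpDl.
by apply: cone_vec_mu => //; have := mulr_ge0 mu_ge0 (ltW e0); lra.
Qed.

Lemma not_cone_vec_mu (d : R) : 0 <= d -> ~ Gamma (vec_head_tail (- mu * d) d).
Proof.
have [_ nmu] := (boundaryP _).1 mu_bd.
rewrite le_eqVlt => /predU1P[<-|d0] g.
  have := adm_upper adm g; rewrite /positive_trace /= mulr0 big1 ?ltxx// => i _.
  by rewrite mxE; case: ifP.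
apply: nmu; have p : 0 < d^-1 by rewrite invr_gt0.
move: g => /(adm_cone adm p); rewrite vec_head_tailZ mulVf ?gt_eqF//.
by rewrite mulrCA mulVf ?gt_eqF// mulr1.
Qed.

End Mu.

(** As [mu_plus] is chosen by [get], it suffices to exhibit one element of the set: the supremum of
    all [m] with (-m, 1, ..., 1) in the cone. Positivity of the trace bounds it by [n - 1], and
    openness of the cone shows that it is not attained. *)
Lemma mu_plusP : (0 < n)%N -> 0 <= mu_plus Gamma <= n%:R - 1 /\
  boundary Gamma (vec_head_tail (- mu_plus Gamma) 1).
Proof.
move=> n0.
suff : [set m : R | 0 <= m <= n%:R - 1 /\ boundary Gamma (vec_head_tail (- m) 1)] !=set0.
  by move=> /getPex.
pose S := [set m : R | Gamma (vec_head_tail (- m) 1)].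
have Sneg m : m < 0 -> S m.
  by move=> m0; apply: (adm_lower adm) => i; rewrite mxE; case: ifP; rewrite ?oppr_gt0.
have Sub : ubound S (n%:R - 1).
  move=> m /= /(adm_upper adm); rewrite /positive_trace /=.
  case: n n0 => [//|p] _.
  rewrite big_ord_recl mxE /=.
  under eq_bigr do rewrite mxE /=.
  by rewrite sumr_const card_ord -[in m <= _]natr1 => h; lra.
have hS : has_sup S by split; [exists (-1); apply: Sneg; lra|exists (n%:R - 1)].
exists (sup S); split; first (apply/andP; split).
- rewrite leNgt; apply/negP => s0.
  have : sup S / 2 <= sup S by apply: sup_upper_bound => //; apply: Sneg; lra.
  by lra.
- by apply: ge_sup => //; case: hS.
apply/boundaryP; split.
  apply/closure_vecP => e e0; have [m Sm hm] := sup_adherent e0 hS.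
  by apply: cone_vec_mono Sm; lra.
move=> /cone_shrink[e e0 g].
suff : sup S + e <= sup S by lra.
apply: sup_upper_bound => //; rewrite /S /=.
have E : vec_head_tail (- sup S) 1 - const_mx e = vec_head_tail (- sup S - e) (1 - e) :> 'rV[R]_n.
  by apply/rowP => i; rewrite !mxE; case: ifP.
by rewrite E in g; apply: cone_vec_mono g; lra.
Qed.

End Cones.

(** * Eigenvalues and rank one perturbations of scalar matrices *)

Section RankOne.
Context {R : realType} {n : nat}.
Implicit Types (x v l : 'rV[R]_n) (a b : R).

Definition rank_one_mx a b x : 'M[R]_n := a%:M + b *: (x^T *m x).

Lemma rank_one_mxE a b x i j :
  rank_one_mx a b x i j = a * (i == j)%:R + b * (x 0 i * x 0 j).
Proof.
rewrite !mxE mulr_natr; congr (_ + _ * _).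
by rewrite big_ord1 !mxE.
Qed.

Lemma quad_form_rank_one a b x v :
  quad_form (rank_one_mx a b x) v = a * dot v v + b * dot v x ^+ 2.
Proof.
rewrite /quad_form /dot expr2 mulr_suml !mulr_sumr -big_split; apply: eq_bigr => i _ /=.
rewrite mulr_sumr mulr_sumr.
have -> : a * (v 0 i * v 0 i) = \sum_j a * (i == j)%:R * (v 0 i * v 0 j).
  rewrite (bigD1 i)//= eqxx mulr1 big1 ?addr0// => j /negPf ji.
  by rewrite eq_sym ji mulr0 mul0r.
rewrite -big_split; apply: eq_bigr => j _ /=; rewrite rank_one_mxE; ring.
Qed.

Lemma mxtrace_rank_one a b x : \tr (rank_one_mx a b x) = n%:R * a + b * dot x x.
Proof.
rewrite /mxtrace; under eq_bigr do rewrite rank_one_mxE eqxx mulr1.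
by rewrite big_split /= sumr_const card_ord -mulr_sumr mulr_natl.
Qed.

Lemma eigenvalue_vector_trace (A : 'M[R]_n) l : (0 < n)%N ->
  eigenvalue_vector A l -> \sum_i l 0 i = \tr A.
Proof.
move=> n0 hl; have := char_poly_trace A n0; rewrite hl.
have -> : \prod_(i < n) ('X - (l 0 i)%:P) =
    \prod_(p <- [seq l 0 i | i <- enum 'I_n]) ('X - p%:P).
  by rewrite big_map big_enum.
have := @coefPn_prod_XsubC R [seq l 0 i | i <- enum 'I_n].
rewrite size_map size_enum_ord => -> //; last by rewrite -lt0n.
by rewrite big_map big_enum => /oppr_inj.
Qed.

Lemma eigenvalue_vector_root (A : 'M[R]_n) l i :
  eigenvalue_vector A l -> exists2 v : 'rV[R]_n, v != 0 & v *m A = l 0 i *: v.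
Proof.
move=> hl; have : eigenvalue A (l 0 i).
  rewrite eigenvalue_root_char hl /root horner_prod.
  by apply/eqP; rewrite (bigD1 i)//= hornerXsubC subrr mul0r.
by move=> /eigenvalueP[v hv v0]; exists v.
Qed.

(** An eigenvector orthogonal to [x] has eigenvalue [a]; otherwise taking the dot product of the
    eigenvalue equation with [x] gives the other value. *)
Lemma rank_one_eigenvalue a b x l i : eigenvalue_vector (rank_one_mx a b x) l ->
  l 0 i = a \/ l 0 i = a + b * dot x x.
Proof.
move=> /(eigenvalue_vector_root i)[v v0].
rewrite mulmxDr mul_mx_scalar -scalemxAr mulmxA => hv.
have {}hv j : a * v 0 j + b * (dot v x * x 0 j) = l 0 i * v 0 j.
  have /rowP/(_ j) := hv; rewrite !mxE big_ord1 !mxE => <-.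
  by congr (_ + _ * (_ * _)); apply: eq_bigr => k _; rewrite !mxE.
have [s0|s0] := eqVneq (dot v x) 0.
  left; have /rV0Pn[j vj] := v0.
  by have := hv j; rewrite s0 mul0r mulr0 addr0 => /(mulIf vj).
right; apply: (mulIf s0).
transitivity (\sum_j (a * (v 0 j * x 0 j) + b * dot v x * (x 0 j * x 0 j))).
  rewrite [LHS]mulr_sumr; apply: eq_bigr => j _.
  have h := hv j.
  transitivity ((l 0 i * v 0 j) * x 0 j); first by rewrite mulrA.
  by rewrite -h; ring.
by rewrite big_split /= -!mulr_sumr -/(dot v x) -/(dot x x); ring.
Qed.

Lemma rank_one_eigenvalues a b x l : (0 < n)%N ->
  eigenvalue_vector (rank_one_mx a b x) l ->
  exists s : 'S_n, vec_head_tail (a + b * dot x x) a = col_perm s l.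
Proof.
move=> n0 hl; pose i0 := Ordinal n0.
have tr := eigenvalue_vector_trace n0 hl.
have hli i := rank_one_eigenvalue i hl.
move: hli tr; rewrite mxtrace_rank_one; set t := b * dot x x => hli tr.
have [t0|t0] := eqVneq t 0.
  exists 1%g; apply/rowP => i; rewrite !mxE perm1 t0 addr0 if_same.
  by have := hli i; rewrite t0 addr0; case.
pose S := finset (fun i => l 0 i == a + t).
have lE i : l 0 i = a + (i \in S)%:R * t.
  rewrite inE; have [->|/eqP ne] := eqVneq (l 0 i) (a + t); first by rewrite mul1r.
  by rewrite mul0r addr0; case: (hli i).
(* The trace counts the coordinates equal to [a + t], since [t] is nonzero. *)
have S1 : #|S| = 1%N.
  move: tr; under eq_bigr do rewrite lE.
  rewrite big_split /= sumr_const card_ord mulr_natl => /addrI.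
  rewrite -mulr_suml -natr_sum -[RHS]mul1r => /(mulIf t0) /eqP.
  by rewrite -big_mkcond sum1_card pnatr_eq1 => /eqP.
have /eqP/cards1P[i1 Si1] := S1.
exists (tperm i0 i1); apply/rowP => i; rewrite !mxE lE Si1 inE.
have [->|ne] := eqVneq i i0; first by rewrite tpermL eqxx mul1r.
have -> : (i == 0 :> nat)%N = false by apply: contraNF ne => /eqP h; apply/eqP/val_inj.
rewrite (canF_eq (tpermK _ _)) tpermR (negPf ne) mul0r addr0 //.
Qed.

End RankOne.

(** * Monotonicity of the eigenvalue conditions with respect to quadratic forms *)

Section Monotone.
Context {R : realType} {n : nat} {Gamma : set 'rV[R]_n}.
Context (adm : admissible Gamma) (n_gt1 : (1 < n)%N).
Implicit Types (x v l : 'rV[R]_n) (A : 'M[R]_n).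

Let n_gt0 : (0 < n)%N. Proof. exact: ltnW. Qed.
Let i0 := Ordinal n_gt0.

Lemma ord_eq_i0 (i : 'I_n) : (i == 0 :> nat)%N = (i == i0).
Proof. by apply/eqP/eqP => [h|->//]; exact: val_inj. Qed.

(* Average of the permutations of [l] that put [l i] in the first position. *)
Lemma cone_average l (i : 'I_n) : Gamma l ->
  Gamma (vec_head_tail (l 0 i) ((\sum_j l 0 j - l 0 i) / (n%:R - 1))).
Proof.
move=> gl; pose v := col_perm (tperm i0 i) l.
have gv : Gamma v by apply: (adm_sym adm).
have vi0 : v 0 i0 = l 0 i by rewrite mxE tpermL.
have vs : \sum_j v 0 j = \sum_j l 0 j.
  rewrite [RHS](reindex_inj (@perm_inj _ (tperm i0 i))); apply: eq_bigr => j _.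
  by rewrite mxE.
rewrite -vi0 -vs; set T := \sum_j v 0 j.
(* Summing over the stabilizer of [i0] keeps the first coordinate, up to the factor [N], and makes
   all the others equal: multiplying by a transposition of two indices other than [i0] permutes the
   stabilizer. *)
pose H := [pred s : 'S_n | s i0 == i0].
pose N : R := #|H|%:R.
have N0 : 0 < N by rewrite ltr0n; apply/card_gt0P; exists 1%g; rewrite inE perm1.
pose g := \sum_(s | H s) (1 : R) *: col_perm s v.
have gg : Gamma g.
  apply: (cone_sum adm) => //; first by rewrite sumr_const.
  by move=> s _; apply: (adm_sym adm).
have gi0 : g 0 i0 = N * v 0 i0.
  rewrite summxE (eq_bigr (fun=> v 0 i0)); first by rewrite sumr_const mulr_natl.
  by move=> s /= /eqP h; rewrite !mxE h mul1r.
have geq j k : j != i0 -> k != i0 -> g 0 j = g 0 k.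
  move=> ji ki; rewrite !summxE.
  rewrite (reindex_inj (mulgI (tperm j k))) /=; apply: eq_big => s.
    by rewrite permM tpermD.
  by move=> _; rewrite !mxE permM tpermL.
have gT : \sum_j g 0 j = N * T.
  under eq_bigr do rewrite summxE.
  rewrite exchange_big /= (eq_bigr (fun=> T)); first by rewrite sumr_const mulr_natl.
  move=> s _; rewrite /T [RHS](reindex_inj (@perm_inj _ s)); apply: eq_bigr => j _.
  by rewrite !mxE mul1r.
have n1 : 0 < n%:R - 1 :> R by rewrite subr_gt0 ltr1n.
have gj j : j != i0 -> g 0 j = N * ((T - v 0 i0) / (n%:R - 1)).
  move=> ji; rewrite mulrA; apply: (mulIf (lt0r_neq0 n1)); rewrite divfK ?gt_eqF//.
  move: gT; rewrite (bigD1 i0)//= gi0 (eq_bigr (fun=> g 0 j)); last first.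
    by move=> k ki; apply: geq.
  rewrite sumr_const.
  have -> : #|[pred k | k != i0]| = n.-1 by rewrite cardC1 card_ord.
  move=> h; rewrite [RHS]mulrBr -h.
  have -> : n%:R - 1 = n.-1%:R :> R by rewrite -[n in LHS]prednK// -natr1 addrK.
  by rewrite mulr_natr addrAC subrr add0r.
have -> : vec_head_tail (v 0 i0) ((T - v 0 i0) / (n%:R - 1)) = N^-1 *: g.
  apply/rowP => j; rewrite mxE [RHS]mxE ord_eq_i0.
  have [->|ji] := eqVneq j i0; first by rewrite gi0 mulKf// gt_eqF.
  by rewrite gj// mulKf// gt_eqF.
by apply: (adm_cone adm) => //; rewrite invr_gt0.
Qed.

Context (a b : R) (x : 'rV[R]_n) (x_neq0 : 0 < dot x x).
Let M := rank_one_mx a b x.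
Let c := a + b * dot x x.

(** Let [w i] be the weight of the normalized [x] on the [i]-th eigenvector of [A]. Evaluating both
    forms at that eigenvector gives [l 0 i >= a + (c - a) * w i], so [l] dominates the convex
    combination, with weights [w], of the vectors having [c] in position [i] and [a] elsewhere. *)
Lemma eigenvalues_in_closure_mono A : A^T = A ->
  (forall v, quad_form M v <= quad_form A v) ->
  closure Gamma (vec_head_tail c a) -> eigenvalues_in A (closure Gamma).
Proof.
move=> As AM hc; have [l [X [Y [hl lE XY1 sumw _]]]] := spectral_real As.
exists l => //; apply/(closure_coneP adm) => e e0.
pose w i := (dot (row i X) x ^+ 2 + dot (row i Y) x ^+ 2) / dot x x.
have w0 i : 0 <= w i by rewrite divr_ge0 ?addr_ge0 ?sqr_ge0// ltW.
have w1 : \sum_i w i = 1 by rewrite -mulr_suml sumw divff// gt_eqF.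
have lge i : a + (c - a) * w i <= l 0 i.
  rewrite lE; apply: le_trans (lerD (AM _) (AM _)).
  rewrite !quad_form_rank_one addrACA -!mulrDr XY1 mulr1.
  have -> : c - a = b * dot x x by rewrite /c; ring.
  by rewrite lerD2l -mulrA [dot x x * _]mulrC divfK ?gt_eqF.
pose g i := col_perm (tperm i0 i) (vec_head_tail (c + e) (a + e)) : 'rV[R]_n.
have gg : Gamma (\sum_i w i *: g i).
  apply: (cone_sum adm) => //; first by rewrite w1.
  by move=> i _; apply: (adm_sym adm); exact: (closure_vecP adm _ _).1.
have -> : l + const_mx e = \sum_i w i *: g i + (l + const_mx e - \sum_i w i *: g i).
  by rewrite [RHS]addrC subrK.
apply: (coneD_nonneg adm gg) => j; rewrite !mxE summxE.
have -> : \sum_i (w i *: g i) 0 j = a + e + w j * (c - a).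
  transitivity (\sum_i (w i * (a + e) + w i * ((c - a) * (i == j)%:R))).
    apply: eq_bigr => i _; rewrite !mxE ord_eq_i0 (canF_eq (tpermK _ _)) tpermL [j == i]eq_sym.
    by case: (i == j) => /=; ring.
  rewrite big_split /= -mulr_suml w1 mul1r; congr (_ + _).
  rewrite (bigD1 j)//= eqxx mulr1 big1 ?addr0// => i /negPf ->.
  by rewrite !mulr0.
have := lge j; rewrite mulrC; lra.
Qed.

(** In an eigenbasis, each nonnegative eigenvalue is multiplied by a squared coordinate of [x],
    which is at most [dot x x]. *)
Lemma quad_form_le_trace A : A^T = A -> (forall v, 0 <= quad_form A v) ->
  quad_form A x <= \tr A * dot x x.
Proof.
move=> As A0; have [l [X [Y [hl lE XY1 sumw qE]]]] := spectral_real As.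
rewrite -qE -(eigenvalue_vector_trace n_gt0 hl) mulr_suml; apply: ler_sum => i _.
apply: ler_wpM2l; first by rewrite lE addr_ge0.
rewrite -sumw [leRHS](bigD1 i)//= lerDl sumr_ge0// => j _.
by rewrite addr_ge0 ?sqr_ge0.
Qed.

(** By contraposition: if [l] is in the cone, averaging the vectors of [cone_average] with the
    weights [w] gives a vector (c', d', ..., d') of the cone, where [c'] is the Rayleigh quotient of
    [A] at [x]. It remains to see that [c' <= c] and [d' <= a]. *)
Lemma eigenvalues_notin_mono A : A^T = A ->
  (forall v, quad_form A v <= quad_form M v) ->
  ~ Gamma (vec_head_tail c a) -> eigenvalues_in A (~` Gamma).
Proof.
move=> As AM hc; have [l [X [Y [hl lE XY1 sumw qE]]]] := spectral_real As.
exists l => // gl; apply: hc.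
pose w i := (dot (row i X) x ^+ 2 + dot (row i Y) x ^+ 2) / dot x x.
have w0 i : 0 <= w i by rewrite divr_ge0 ?addr_ge0 ?sqr_ge0// ltW.
have w1 : \sum_i w i = 1 by rewrite -mulr_suml sumw divff// gt_eqF.
have n1 : 0 < n%:R - 1 :> R by rewrite subr_gt0 ltr1n.
pose T := \sum_j l 0 j.
pose c' := \sum_i w i * l 0 i.
have gg : Gamma (\sum_i w i *: vec_head_tail (l 0 i) ((T - l 0 i) / (n%:R - 1))).
  apply: (cone_sum adm) => //; first by rewrite w1.
  by move=> i _; exact: cone_average.
have E : \sum_i w i *: vec_head_tail (l 0 i) ((T - l 0 i) / (n%:R - 1))
    = vec_head_tail c' ((T - c') / (n%:R - 1)) :> 'rV[R]_n.
  apply/rowP => j; rewrite summxE mxE.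
  under eq_bigr do rewrite !mxE.
  case: ifP => _ //.
  under eq_bigr do rewrite mulrA mulrBr.
  by rewrite -mulr_suml sumrB -mulr_suml w1 mul1r.
rewrite E in gg.
have c'E : c' * dot x x = quad_form A x.
  rewrite -qE /c' mulr_suml; apply: eq_bigr => i _.
  by rewrite /w mulrC mulrA mulrC [_ * (_ / _)]mulrC divfK ?gt_eqF// mulrC.
have cE : c * dot x x = quad_form M x by rewrite quad_form_rank_one /c; ring.
have Ms : (M - A)^T = M - A.
  rewrite linearB /= As; congr (_ - _); apply/matrixP => i j.
  by rewrite mxE !rank_one_mxE eq_sym [x 0 j * _]mulrC.
have qB v : quad_form (M - A) v = quad_form M v - quad_form A v.
  rewrite /quad_form -sumrB; apply: eq_bigr => i _; rewrite -sumrB.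
  apply: eq_bigr => j _; rewrite !mxE; ring.
(* Applied to the nonnegative form [M - A], the trace bound gives [T - c' <= (n - 1) * a], which is
   the bound on the tail. *)
have := quad_form_le_trace Ms; rewrite qB linearB /= -(eigenvalue_vector_trace n_gt0 hl).
rewrite mxtrace_rank_one -cE -c'E -mulrBl ler_pM2r// => htr.
have {}htr : c - c' <= n%:R * a + b * dot x x - T.
  by apply: htr => v; rewrite qB subr_ge0.
apply: (cone_vec_mono adm) gg.
  by rewrite -(ler_pM2r x_neq0) cE c'E.
by rewrite ler_pdivrMr//; move: htr; rewrite /c; lra.
Qed.

End Monotone.

(** * Second-order calculus *)

Section Calculus.
Context {R : realType}.

Lemma is_derive_line {n} (f : 'rV[R]_n -> R) (x v : 'rV[R]_n) (s df : R) :
  is_derive (s *: v + x) v f df <-> is_derive s 1 (fun h => f (h *: v + x)) df.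
Proof.
have E : (fun h : R => h^-1 *: ((f \o shift (s *: v + x)) (h *: v) - f (s *: v + x)))
   = (fun h : R => h^-1 *: (((fun h => f (h *: v + x)) \o shift s) (h *: 1) - f (s *: v + x))).
  by apply/funext => h /=; rewrite addrA -scalerDl [h *: 1]mulr1.
by split=> -[d1 d2]; split; move: d1 d2; rewrite /derivable /derive ?E // -?E.
Qed.

Lemma MVT_from_origin (g dg : R -> R) (s : R) :
  (forall t, `|t| <= `|s| -> is_derive t (1 : R) g (dg t)) ->
  exists2 t, `|t| <= `|s| & g s - g 0 = dg t * s.
Proof.
move=> gd.
have c t : `|t| <= `|s| -> {for t, continuous g}.
  move=> /gd[h _]; apply: differentiable_continuous; exact/derivable1_diffP.
have [s0|s0] := leP 0 s.
  have sub t : t \in `[0, s] -> `|t| <= `|s|.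
    by rewrite in_itv /= => /andP[t0 ts]; rewrite !ger0_norm.
  have [|t ts E] := @MVT_segment R g dg 0 s s0 (fun t h => gd t (sub t (subset_itv_oo_cc h))).
    by apply: continuous_in_subspaceT => t; rewrite inE => /sub /c.
  by exists t; [exact: sub|rewrite E subr0].
have sub t : t \in `[s, 0] -> `|t| <= `|s|.
  by rewrite in_itv /= => /andP[t0 ts]; rewrite !ler0_norm ?(ltW s0)// lerN2.
have [|t ts E] := @MVT_segment R g dg s 0 (ltW s0) (fun t h => gd t (sub t (subset_itv_oo_cc h))).
  by apply: continuous_in_subspaceT => t; rewrite inE => /sub /c.
by exists t; [exact: sub|rewrite -opprB E sub0r mulrN opprK].
Qed.

(** A negative [h2] would make [h1] negative just to the right of 0, and the mean value theorem
    would give values of [h] below [h 0]. *)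
Lemma local_min_second_order (h h1 : R -> R) (h2 : R) :
  (\forall s \near 0, is_derive s (1 : R) h (h1 s)) -> is_derive (0 : R) 1 h1 h2 ->
  (\forall s \near 0, h 0 <= h s) -> h1 0 = 0 /\ 0 <= h2.
Proof.
move=> hd h1d hmin.
have h10 : h1 0 = 0.
  have /nbhs_ballP[e /= e0 he] : \forall s \near 0, is_derive s (1 : R) h (h1 s) /\ h 0 <= h s.
    by apply: filterS2 hd hmin => s ? ?; split.
  have he' t : t \in `]-e, e[ -> is_derive t (1 : R) h (h1 t) /\ h 0 <= h t.
    by rewrite in_itv /= => ht; apply: he; rewrite -ball_normE /= sub0r normrN ltr_norml.
  have z : (0 : R) \in `]-e, e[ by rewrite in_itv /= oppr_lt0 e0.
  have := derive1_at_min (f := h) (a := -e) (b := e) (c := 0).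
  have ee : - e <= e by lra.
  move=> /(_ ee (fun t ht => @ex_derive _ _ _ _ _ _ _ (he' t ht).1) z (fun t ht => (he' t ht).2)).
  by case=> _ D0; have [[_ D1] _] := he' 0 z; rewrite -D1 D0.
split=> //; rewrite leNgt; apply/negP => h20.
have [dh1 dh2] := h1d.
have : h^-1 *: (h1 (h *: 1 + 0) - h1 0) @[h --> 0^'] --> h2.
  by rewrite -dh2; exact: dh1.
move=> /cvgr_lt /(_ _ h20); rewrite near_withinE => /nbhs_ballP[d /= d0 hdn].
have /nbhs_ballP[e /= e0 he] : \forall s \near 0, is_derive s (1 : R) h (h1 s) /\ h 0 <= h s.
  by apply: filterS2 hd hmin => s ? ?; split.
pose s := Num.min d e / 2.
have s0 : 0 < s by rewrite divr_gt0// lt_min d0.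
have sm : s < Num.min d e.
  by rewrite /s ltr_pdivrMr// ltr_pMr ?ltr1n// lt_min d0.
have [sd se] : s < d /\ s < e.
  by split; apply: lt_le_trans sm _; rewrite ge_min lexx ?orbT.
have sub (t : R) : t \in `]0, s[ -> ball (0 : R) e t /\ ball (0 : R) d t.
  rewrite in_itv /= => /andP[t0 ts].
  by rewrite -ball_normE /= sub0r normrN gtr0_norm// !(lt_trans ts).
have hs : ball (0 : R) e s by rewrite -ball_normE /= sub0r normrN gtr0_norm.
have [||t ts E] := @MVT R h h1 0 s s0.
- by move=> t /sub[/he[]].
- apply: continuous_in_subspaceT => t; rewrite inE /= in_itv /= => /andP[t0 ts].
  have /he[[dt _] _] : ball (0 : R) e t.
    by rewrite -ball_normE /= sub0r normrN ger0_norm// (le_lt_trans ts).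
  by apply: differentiable_continuous; exact/derivable1_diffP.
have [_ hle] := he _ hs.
have [_ td] := sub _ ts.
have t0 : 0 < t by move: ts; rewrite in_itv /= => /andP[].
have := hdn t td; rewrite gt_eqF// => /(_ isT).
rewrite h10 subr0 addr0 /GRing.scale /= mulr1 => ht.
have h1t : h1 t < 0 by move: ht; rewrite pmulr_rlt0 ?invr_gt0.
have : h s - h 0 < 0 by rewrite E subr0 nmulr_rlt0.
by rewrite subr_lt0 ltNge hle.
Qed.

End Calculus.

(** * Second-order conditions and mixed derivatives in several variables *)

Section MultivariableCalculus.
Context {R : realType} {n : nat}.
Implicit Types (x v w y : 'rV[R]_n) (i j : 'I_n).

Local Notation bas i := (delta_mx 0 i : 'rV[R]_n).

Lemma is_derive_cvgP f x v (d : R) : is_derive x v f d <->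
  h^-1 * (f (h *: v + x) - f x) @[h --> 0^'] --> d.
Proof.
split=> [[d1 <-]|h]; first exact: d1.
by split; [apply: cvgP h|apply: cvg_lim h].
Qed.

(* Iterated over the coordinates, this yields the chain rule along lines from
   continuous partial derivatives. *)
Lemma is_derive_add_coord f (fi : 'rV[R]_n -> R) x w i (d c : R) :
  is_derive x w f d -> (\forall y \near x, is_derive y (bas i) f (fi y)) ->
  {for x, continuous fi} -> is_derive x (w + c *: bas i) f (d + c * fi x).
Proof.
move=> /is_derive_cvgP fw near_fi fic; apply/is_derive_cvgP.
(* Move first along [w], then along the coordinate direction; the second piece is handled by the
   mean value theorem and continuity of [fi] at [x]. *)
have E (h : R) : h^-1 * (f (h *: (w + c *: bas i) + x) - f x) =
    h^-1 * (f (h *: w + x) - f x) +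
    h^-1 * (f ((h * c) *: bas i + (h *: w + x)) - f (h *: w + x)).
  have -> : h *: (w + c *: bas i) + x = (h * c) *: bas i + (h *: w + x).
    by rewrite scalerDr scalerA addrAC addrC.
  by ring.
under eq_fun do rewrite E.
apply: cvgD => //.
apply/cvgrPdist_le => /= e e0.
have c1 : 0 < `|c| + 1 by rewrite ltr_wpDl.
have e1 : 0 < e / (`|c| + 1) by rewrite divr_gt0.
have near2 : \forall y \near x, `|fi x - fi y| <= e / (`|c| + 1).
  by have /cvgrPdist_le := fic; apply.
have /nbhs_ballP[r /= r0 hr] : \forall y \near x, is_derive y (bas i) f (fi y) /\
    `|fi x - fi y| <= e / (`|c| + 1).
  by apply: filterS2 near_fi near2 => y ? ?; split.
(* Bounds the displacement per unit of [h], so that the whole path stays in the ball of radius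
   [r]. *)
pose K := `|w| + `|c| * `|bas i| + 1.
have K0 : 0 < K by rewrite ltr_wpDl// addr_ge0 ?mulr_ge0.
near=> h.
have h0 : h != 0 by near: h; exact: nbhs_dnbhs_neq.
have hK : `|h| * K < r.
  rewrite -ltr_pdivlMr//; near: h; apply: dnbhs0_lt; exact: divr_gt0.
have inball s : `|s| <= `|h * c| -> ball x r (s *: bas i + (h *: w + x)).
  move=> sh; rewrite -ball_normE /= [in X in x - X]addrA opprD addrCA subrr addr0 normrN.
  apply: (le_lt_trans (ler_normD _ _)); rewrite !normrZ; apply: le_lt_trans hK.
  rewrite /K addrC !mulrDr mulr1 mulrA -normrM -addrA lerD2l ler_wpDr//.
  by rewrite ler_wpM2r.
have [t th E2] := @MVT_from_origin R (fun s => f (s *: bas i + (h *: w + x)))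
  (fun s => fi (s *: bas i + (h *: w + x))) (h * c)
  (fun s hs => (is_derive_line f _ _ _ _).1 (hr _ (inball s hs)).1).
rewrite scale0r add0r in E2; rewrite E2.
have -> : h^-1 * (fi (t *: bas i + (h *: w + x)) * (h * c)) =
   c * fi (t *: bas i + (h *: w + x)) by field.
rewrite -mulrBr normrM.
have [_ h2] := hr _ (inball t th).
apply: (le_trans (ler_wpM2l (normr_ge0 c) h2)).
rewrite mulrA ler_pdivrMr// mulrC ler_pM2l//; lra.
Unshelve. all: by end_near. Qed.

Record C2_at f (f1 : 'I_n -> 'rV[R]_n -> R) (f2 : 'I_n -> 'I_n -> 'rV[R]_n -> R) x : Prop := C2At {
  C2_at_d1 : forall i, \forall y \near x, is_derive y (bas i) f (f1 i y);
  C2_at_c1 : forall i, \forall y \near x, {for y, continuous (f1 i)};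
  C2_at_d2 : forall i j, \forall y \near x, is_derive y (bas j) (f1 i) (f2 i j y);
  C2_at_c2 : forall i j, {for x, continuous (f2 i j)} }.

Lemma C2_atB f f1 f2 g g1 g2 x : C2_at f f1 f2 x -> C2_at g g1 g2 x ->
  C2_at (fun y => f y - g y) (fun i y => f1 i y - g1 i y)
        (fun i j y => f2 i j y - g2 i j y) x.
Proof.
move=> [F1 F2 F3 F4] [G1 G2 G3 G4]; split.
- by move=> i; apply: filterS2 (F1 i) (G1 i) => y ? ?; exact: is_deriveB.
- by move=> i; apply: filterS2 (F2 i) (G2 i) => y hf hg; exact: (cvgB hf hg).
- by move=> i j; apply: filterS2 (F3 i j) (G3 i j) => y ? ?; exact: is_deriveB.
- by move=> i j; exact: (cvgB (F4 i j) (G4 i j)).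
Qed.

Lemma is_derive_gradient f (f1 : 'I_n -> 'rV[R]_n -> R) x v :
  (forall i, \forall y \near x, is_derive y (bas i) f (f1 i y)) ->
  (forall i, {for x, continuous (f1 i)}) ->
  is_derive x v f (\sum_i v 0 i * f1 i x).
Proof.
move=> fd fc.
suff : is_derive x (\sum_i v 0 i *: bas i) f (\sum_i v 0 i * f1 i x).
  by rewrite -row_sum_delta.
elim: (index_enum _) => [|i s IH]; first by rewrite !big_nil; exact: is_derive0.
rewrite !big_cons addrC [X in is_derive _ _ _ X]addrC.
exact: is_derive_add_coord.
Qed.

(** The one-variable test is applied to the restriction of [f] to every line through [x]. *)
Lemma second_order_test f f1 f2 x : C2_at f f1 f2 x ->
  (\forall y \near x, f x <= f y) ->
  (forall i, f1 i x = 0) /\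
  (forall v, 0 <= \sum_i \sum_j v 0 i * v 0 j * f2 i j x).
Proof.
move=> [F1 F2 F3 F4] fmin.
have test v : \sum_i v 0 i * f1 i x = 0 /\ 0 <= \sum_i \sum_j v 0 i * v 0 j * f2 i j x.
  have line_cvg : (fun s : R => s *: v + x) @ nbhs (0 : R) --> x.
    have : (fun s : R => s *: v + x) @ nbhs (0 : R) --> 0 *: v + x.
      by apply: cvgD; [apply: cvgZl; exact: cvg_id|exact: cvg_cst].
    by rewrite scale0r add0r.
  have pull (P : 'rV[R]_n -> Prop) : (\forall y \near x, P y) ->
      \forall s \near (0 : R), P (s *: v + x) by move=> h; exact: (line_cvg _ h).
  have near_all (P : 'I_n -> 'rV[R]_n -> Prop) : (forall i, \forall y \near x, P i y) ->
      \forall y \near x, forall i, P i y by move=> h; exact: (@filter_forall _ 'I_n P (nbhs x) _ h).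
  have h1 : \forall s \near (0 : R), is_derive s (1 : R) (fun s => f (s *: v + x))
      (\sum_i v 0 i * f1 i (s *: v + x)).
    have F1' := nbhs_interior (near_all _ F1).
    have : \forall y \near x, is_derive y v f (\sum_i v 0 i * f1 i y).
      apply: filterS2 F1' (near_all _ F2) => y h1 h2; apply: is_derive_gradient => // i.
      by apply: filterS h1 => z; exact.
    by move=> /pull; apply: filterS => s /is_derive_line.
  have h2 : is_derive (0 : R) 1 (fun s => \sum_i v 0 i * f1 i (s *: v + x))
      (\sum_i v 0 i * (\sum_j v 0 j * f2 i j x)).
    have hi i : is_derive (0 : R) 1 (fun s => v 0 i * f1 i (s *: v + x))
        (v 0 i * (\sum_j v 0 j * f2 i j x)).
      apply: is_deriveZ; apply/is_derive_line; rewrite scale0r add0r.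
      by apply: is_derive_gradient => j.
    have := is_derive_sum hi; rewrite (_ : \sum_(i < n) _ = (fun s => \sum_i v 0 i * f1 i (s *: v + x))) //.
    by apply/funext => s; rewrite fct_sumE.
  have h3 : \forall s \near (0 : R), (fun s => f (s *: v + x)) 0 <= (fun s => f (s *: v + x)) s.
    by move: fmin => /pull; apply: filterS => s; rewrite scale0r add0r.
  have [] := local_min_second_order h1 h2 h3; rewrite scale0r add0r => -> h; split=> //.
  move: h; congr (_ <= _); apply: eq_bigr => i _; rewrite mulr_sumr.
  by apply: eq_bigr => j _; rewrite mulrA.
split=> [i|v]; last by case: (test v).
have [+ _] := test (bas i); rewrite (bigD1 i)//= big1 ?addr0 ?mxE ?eqxx ?mul1r//.
by move=> j /negPf ji; rewrite mxE ji andbF mul0r.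
Qed.

(** Two applications of the mean value theorem, in direction [i] and then [j], turn the difference
    over a square of side [s] into a value of [f2 i j] near [x]. *)
Lemma second_difference f f1 f2 x i j : C2_at f f1 f2 x ->
  forall e : R, 0 < e -> \forall s \near 0^'+,
  `|(f (s *: bas i + (s *: bas j + x)) - f (s *: bas i + x)
     - (f (s *: bas j + x) - f x)) / s ^+ 2 - f2 i j x| <= e.
Proof.
move=> [F1 F2 F3 F4] e e0.
have /nbhs_ballP[r /= r0 hr] : \forall y \near x, [/\ is_derive y (bas i) f (f1 i y),
   is_derive y (bas j) (f1 i) (f2 i j y) & `|f2 i j x - f2 i j y| <= e].
  have near2 : \forall y \near x, `|f2 i j x - f2 i j y| <= e.
    by have /cvgrPdist_le := F4 i j; apply.
  by apply: filterS3 (F1 i) (F3 i j) near2 => y ? ? ?; split.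
have bas1 (k : 'I_n) : `|bas k| <= 1.
  rewrite [leLHS]/Num.norm /= mx_normrE; apply/bigmax_leP; split=> // -[a b] _ /=.
  by rewrite mxE; case: (_ && _); rewrite ?normr1 ?normr0.
near=> s.
have s0 : 0 < s by near: s; exact: nbhs_right_gt.
have sr : s < r / 2 by near: s; apply: nbhs_right_lt; rewrite divr_gt0.
have inball (a b : R) : `|a| <= `|s| -> `|b| <= `|s| -> ball x r (a *: bas i + (b *: bas j + x)).
  rewrite [`|s|]gtr0_norm// => ha hb.
  rewrite -ball_normE /= [in X in x - X]addrA opprD addrCA subrr addr0 normrN.
  apply: (le_lt_trans (ler_normD _ _)); rewrite !normrZ.
  have h1 : `|a| * `|bas i| <= s by rewrite (le_trans _ ha)// ler_piMr.
  have h2 : `|b| * `|bas j| <= s by rewrite (le_trans _ hb)// ler_piMr.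
  by move: sr; lra.
have z0 : `|0 : R| <= `|s| by rewrite normr0.
(* The [eq_ind] term only replaces [0 *: bas j + x] by [x] in the derivative on the lower side of
   the square. *)
have [t ts E1] := @MVT_from_origin R
  (fun t => f (t *: bas i + (s *: bas j + x)) - f (t *: bas i + x))
  (fun t => f1 i (t *: bas i + (s *: bas j + x)) - f1 i (t *: bas i + x)) s
  (fun t ht => is_deriveB
     ((is_derive_line f _ _ _ _).1 (let: And3 p _ _ := hr _ (inball t s ht (lexx _)) in p))
     ((is_derive_line f _ _ _ _).1 (eq_ind _ (fun y => is_derive y (bas i) f (f1 i y))
        (let: And3 p _ _ := hr _ (inball t 0 ht z0) in p) _
        (congr1 (fun z => t *: bas i + z) (eq_trans (congr1 (fun z => z + x) (scale0r _)) (add0r _)))))).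
have [t' ts' E2] := @MVT_from_origin R (fun b => f1 i (b *: bas j + (t *: bas i + x)))
  (fun b => f2 i j (b *: bas j + (t *: bas i + x))) s
  (fun b hb => (is_derive_line (f1 i) _ _ _ _).1
    (eq_ind _ (fun y => is_derive y (bas j) (f1 i) (f2 i j y))
        (let: And3 _ p _ := hr _ (inball t b ts hb) in p) _ (addrCA _ _ _))).
move: E1 E2; rewrite !scale0r !add0r => E1.
rewrite E1 [s *: bas j + _]addrCA => ->.
have [_ _] := hr _ (inball t t' ts ts'); rewrite addrCA distrC.
congr (`| _ - _| <= _); rewrite expr2; field.
exact: lt0r_neq0.
Unshelve. all: by end_near. Qed.

(** The second difference is symmetric in the two directions and approximates both mixed
    derivatives. *)
Lemma schwarz f f1 f2 x i j : C2_at f f1 f2 x -> f2 i j x = f2 j i x.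
Proof.
move=> C; apply/eqP; rewrite -subr_eq0 -normr_le0; apply/ler_addgt0Pr => e e0.
rewrite add0r; have e2 : 0 < e / 2 by rewrite divr_gt0.
have h1 := second_difference i j C e2; have h2 := second_difference j i C e2.
near (0 : R)^'+ => s.
have k1 : `|(f (s *: bas i + (s *: bas j + x)) - f (s *: bas i + x)
     - (f (s *: bas j + x) - f x)) / s ^+ 2 - f2 i j x| <= e / 2 by near: s.
have k2 : `|(f (s *: bas j + (s *: bas i + x)) - f (s *: bas j + x)
     - (f (s *: bas i + x) - f x)) / s ^+ 2 - f2 j i x| <= e / 2 by near: s.
move: k1 k2; rewrite [s *: bas j + (s *: bas i + x)]addrCA.
set A := f (_ + (_ + _)); set B := f (s *: bas j + x); set D := f (s *: bas i + x).
have -> : A - D - (B - f x) = A - B - (D - f x) by ring.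
set Z := _ / _; rewrite distrC => k1 k2.
have -> : f2 i j x - f2 j i x = (f2 i j x - Z) + (Z - f2 j i x) by rewrite addrA subrK.
by apply: le_trans (ler_normD _ _) _; lra.
Unshelve. all: by end_near. Qed.

End MultivariableCalculus.

(** * Conformal Hessian *)

Section ConformalHessian.
Context {R : realType} {n : nat}.
Implicit Types (x v w y : 'rV[R]_n) (i j : 'I_n) (Omega : set 'rV[R]_n).

Local Notation bas i := (delta_mx 0 i : 'rV[R]_n).

Lemma near_eq_continuous {T U : topologicalType} (f g : T -> U) (x : T) :
  (\forall y \near x, f y = g y) -> {for x, continuous f} -> {for x, continuous g}.
Proof.
move=> fg fc; have gx := nbhs_singleton fg.
change (g @ x --> g x); rewrite -gx; apply: cvg_trans fc.
by apply: near_eq_cvg; apply: filterS fg => y ->.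
Qed.

Lemma C2_on_C2_at Omega (f : 'rV[R]_n -> R) x : open Omega -> C2_on Omega f -> Omega x ->
  C2_at f (fun i => partial i f) (fun i j => partial j (partial i f)) x.
Proof.
move=> oO [_ f1 f2] Ox.
have nO : \forall y \near x, Omega y by apply: open_nbhs_nbhs; split.
split=> [i|i|i j|i j].
- by apply: filterS nO => y Oy; apply/derivableP; apply: (f1 i).1.
- have [_] := f1 i; rewrite continuous_open_subspace// => c.
  by apply: filterS nO => y Oy; apply: c; rewrite inE.
- by apply: filterS nO => y Oy; apply/derivableP; apply: (f2 j i).1.
- have [_] := f2 j i; rewrite continuous_open_subspace// => c.
  by apply: c; rewrite inE.
Qed.

Lemma C2_at_partial (f : 'rV[R]_n -> R) f1 f2 x : C2_at f f1 f2 x ->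
  (forall i, partial i f x = f1 i x) /\
  (forall i j, partial j (partial i f) x = f2 i j x).
Proof.
move=> [F1 _ F2 _]; split=> [i|i j]; first by have [_] := nbhs_singleton (F1 i).
have near1 : \forall y \near x, partial i f y = f1 i y by apply: filterS (F1 i) => y [].
rewrite {1}/partial (near_eq_derive _ near1).
by have [_] := nbhs_singleton (F2 i j).
Qed.

Lemma C2_at_C2_on Omega (f : 'rV[R]_n -> R) f1 f2 : open Omega ->
  (forall x, Omega x -> {for x, continuous f}) ->
  (forall x, Omega x -> C2_at f f1 f2 x) -> C2_on Omega f.
Proof.
move=> oO fc fC2.
have nO x : Omega x -> \forall y \near x, Omega y.
  by move=> Ox; apply: open_nbhs_nbhs; split.
have p1 i x : Omega x -> partial i f x = f1 i x by move=> /fC2 /C2_at_partial[].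
have p2 i j x : Omega x -> partial j (partial i f) x = f2 i j x.
  by move=> /fC2 /C2_at_partial[].
split.
- by rewrite continuous_open_subspace// => x; rewrite inE; exact: fc.
- move=> i; split=> [x Ox|].
    by have [+ _] := nbhs_singleton (C2_at_d1 (fC2 x Ox) i).
  rewrite continuous_open_subspace// => x; rewrite inE => Ox.
  apply: (@near_eq_continuous _ _ (f1 i)).
    by apply: filterS (nO _ Ox) => y /p1.
  exact: nbhs_singleton (C2_at_c1 (fC2 x Ox) i).
move=> j i; split=> [x Ox|].
  have [+ _] := nbhs_singleton (C2_at_d2 (fC2 x Ox) i j).
  apply: near_eq_derivable.
  by apply: filterS (nO _ Ox) => y /p1 ->.
rewrite continuous_open_subspace// => x; rewrite inE => Ox.
apply: (@near_eq_continuous _ _ (f2 i j)).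
  by apply: filterS (nO _ Ox) => y /p2.
exact: C2_at_c2 (fC2 x Ox) i j.
Qed.

Lemma conformal_hessian_sym (f : 'rV[R]_n -> R) f1 f2 x : C2_at f f1 f2 x ->
  (conformal_hessian f x)^T = conformal_hessian f x.
Proof.
move=> fC; have [p1 p2] := C2_at_partial fC.
apply/matrixP => i j; rewrite mxE !mxE !p2 (schwarz j i fC) eq_sym.
by rewrite [partial j f x * _]mulrC.
Qed.

(** At a contact point the values and gradients agree, so the two matrices differ by a multiple of
    the Hessian of [f - g], which is nonnegative there; the negative coefficient of the second
    derivatives reverses the order. *)
Lemma conformal_hessian_mono (f g : 'rV[R]_n -> R) f1 f2 g1 g2 x : (2 < n)%N ->
  C2_at f f1 f2 x -> C2_at g g1 g2 x -> f x = g x -> 0 < f x ->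
  (\forall y \near x, g y <= f y) ->
  forall v, quad_form (conformal_hessian f x) v <= quad_form (conformal_hessian g x) v.
Proof.
move=> n2 fC gC fg f0 near_fg v.
have [p1 p2] := C2_at_partial fC; have [q1 q2] := C2_at_partial gC.
have [h1 h2] : (forall i, f1 i x - g1 i x = 0) /\
  (forall v, 0 <= \sum_i \sum_j v 0 i * v 0 j * (f2 i j x - g2 i j x)).
  apply: (second_order_test (C2_atB fC gC)).
  by rewrite fg subrr; apply: filterS near_fg => y; rewrite subr_ge0.
have e1 i : partial i f x = partial i g x.
  by apply/eqP; rewrite p1 q1 -subr_eq0 h1.
have N2 : 0 < n%:R - 2 :> R by rewrite subr_gt0 ltr_nat.
rewrite -subr_ge0 /quad_form -sumrB.
pose K := 2 / (n%:R - 2) * f x `^ (- ((n%:R + 2) / (n%:R - 2))).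
have K0 : 0 <= K by rewrite mulr_ge0 ?powR_ge0// divr_ge0// ltW.
suff -> : \sum_i (\sum_j v 0 i * conformal_hessian g x i j * v 0 j
    - \sum_j v 0 i * conformal_hessian f x i j * v 0 j)
    = K * (\sum_i \sum_j v 0 i * v 0 j * (f2 i j x - g2 i j x)).
  by rewrite mulr_ge0.
rewrite mulr_sumr; apply: eq_bigr => i _; rewrite -sumrB mulr_sumr.
apply: eq_bigr => j _; rewrite !mxE -!e1 -!fg !p2 !q2.
rewrite (schwarz j i fC) (schwarz j i gC).
under eq_bigr do rewrite -e1.
by rewrite /K; ring.
Qed.

Lemma dot_line (y : 'rV[R]_n) i (h : R) :
  dot (h *: bas i + y) (h *: bas i + y) = dot y y + (2 * y 0 i) * h + h ^+ 2.
Proof.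
rewrite /dot (bigD1 i)//= [in RHS](bigD1 i)//= !mxE !eqxx /= mulr1.
rewrite (eq_bigr (fun k => y 0 k * y 0 k)); first by ring.
by move=> k /negPf ki; rewrite !mxE ki /= mulr0 add0r.
Qed.

Lemma is_derive_radial (F : R -> R) dF y i : is_derive (dot y y) (1 : R) F dF ->
  is_derive y (bas i) (fun y => F (dot y y)) (2 * y 0 i * dF).
Proof.
move=> dFy.
suff : is_derive (0 *: bas i + y) (bas i) (fun y => F (dot y y)) (2 * y 0 i * dF).
  by rewrite scale0r add0r.
apply/is_derive_line; under eq_fun do rewrite dot_line.
pose p (h : R) := dot y y + 2 * y 0 i * h + h ^+ 2.
have dp : is_derive (0 : R) 1 p (2 * y 0 i).
  rewrite /p; apply: is_derive_eq.
  by rewrite /GRing.scale /=; ring.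
have p0 : p 0 = dot y y by rewrite /p; ring.
rewrite -p0 in dFy; have h := is_derive1_comp dFy dp.
by apply: (is_derive_eq h); rewrite mulrC.
Qed.

Lemma is_derive_coord y i j :
  is_derive y (bas j) (fun y : 'rV[R]_n => y 0 i) (i == j)%:R.
Proof.
suff : is_derive (0 *: bas j + y) (bas j) (fun y : 'rV[R]_n => y 0 i) (i == j)%:R.
  by rewrite scale0r add0r.
apply/is_derive_line; under eq_fun do rewrite !mxE /=.
apply: is_derive_eq.
by rewrite /GRing.scale /= ?eqxx ?scaler0 ?addr0 ?add0r; ring.
Qed.

Lemma dot_continuous : continuous (fun y : 'rV[R]_n => dot y y).
Proof.
rewrite /dot; apply: continuous_big => [|i _]; first exact: add_continuous.
move=> y; have c := @coord_continuous R 1 n 0 i y; exact: (cvgM c c).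
Qed.

(** Radial functions are expressed through the squared norm, a polynomial, so that the chain rule
    involves no square root. *)
Lemma C2_at_radial (F F1 F2 : R -> R) x :
  (forall q : R, 0 < q -> is_derive q (1 : R) F (F1 q)) ->
  (forall q : R, 0 < q -> is_derive q (1 : R) F1 (F2 q)) ->
  (forall q : R, 0 < q -> {for q, continuous F2}) -> 0 < dot x x ->
  C2_at (fun y => F (dot y y)) (fun i y => 2 * y 0 i * F1 (dot y y))
    (fun i j y => 2 * (i == j)%:R * F1 (dot y y) + 4 * y 0 i * y 0 j * F2 (dot y y)) x.
Proof.
move=> dF dF1 cF2 x0.
have npos : \forall y \near x, 0 < dot y y.
  by have /cvgr_gt := @dot_continuous x; exact.
have cont_comp (G : R -> R) y : {for (dot y y), continuous G} ->
    {for y, continuous (fun y : 'rV[R]_n => G (dot y y))}.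
  by move=> Gc; apply: (@continuous_comp _ _ _ (fun y => dot y y) G) => //; exact: dot_continuous.
have F1c (q : R) : 0 < q -> {for q, continuous F1} by move=> /dF1; exact: is_derive_continuous.
have cc i y : {for y, continuous (fun y : 'rV[R]_n => y 0 i)} by exact: coord_continuous.
have ck (c : R) y : {for y, continuous ((fun=> c) : 'rV[R]_n -> R)} by exact: cst_continuous.
split=> [i|i|i j|i j].
- by apply: filterS npos => y y0; apply: is_derive_radial; exact: dF.
- apply: filterS npos => y y0.
  exact: (cvgM (cvgM (ck 2 y) (cc i y)) (cont_comp F1 y (F1c _ y0))).
- apply: filterS npos => y y0.
  have h := is_deriveM (is_deriveZ 2 (is_derive_coord y i j)) (is_derive_radial j (dF1 _ y0)).
  apply: (is_derive_eq h) => /=; have E (p q : R) : p *: q = p * q by [].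
  rewrite !E; move: (F1 _) (F2 _) (y 0 i) (y 0 j) ((i == j)%:R : R) => f1 f2 yi yj d.
  ring.
- exact: (cvgD (cvgM (ck _ x) (cont_comp F1 x (F1c _ x0)))
    (cvgM (cvgM (cvgM (ck 4 x) (cc i x)) (cc j x)) (cont_comp F2 x (cF2 _ x0)))).
Qed.

End ConformalHessian.

(** * Radial functions in logarithmic coordinates *)

Section CylindricalCoordinates.
Context {R : realType} {n : nat} (n_gt2 : (2 < n)%N).
Implicit Types (x v w y : 'rV[R]_n) (i j : 'I_n) (q t : R).

Let m : R := (n%:R - 2) / 2.

Let N2 : 0 < n%:R - 2 :> R. Proof. by rewrite subr_gt0 ltr_nat. Qed.

Lemma cyl_exponent_gt0 : 0 < m. Proof. by rewrite divr_gt0. Qed.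

(** The argument is the squared norm, so this is the logarithm of the radius. *)
Definition log_radius q : R := ln q / 2.

Definition cyl_profile (eta : R -> R) q : R :=
  expR (- ((n%:R - 2) / 2) * (eta (log_radius q) + log_radius q)).

Definition cyl (eta : R -> R) x : R := cyl_profile eta (dot x x).

Section Profile.
Context {eta eta1 eta2 : R -> R} (C : C2_data eta eta1 eta2).

Definition cyl_profile1 q : R :=
  cyl_profile eta q * (- m * (1 + eta1 (log_radius q)) / (2 * q)).

Definition cyl_profile2 q : R :=
  cyl_profile eta q * ((m ^+ 2 * (1 + eta1 (log_radius q)) ^+ 2
    - m * eta2 (log_radius q) + 2 * m * (1 + eta1 (log_radius q))) / (4 * q ^+ 2)).

Lemma is_derive_log_radius q : 0 < q -> is_derive q (1 : R) log_radius (2 * q)^-1.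
Proof.
move=> q0; have h := is_deriveM (is_derive1_ln q0) (is_derive_cst (2^-1 : R) q (1 : R)).
apply: (is_derive_eq h) => /=; have E (a b : R) : a *: b = a * b by [].
by rewrite !E; field; rewrite gt_eqF.
Qed.

Lemma is_derive_cyl_profile q : 0 < q ->
  is_derive q (1 : R) (cyl_profile eta) (cyl_profile1 q).
Proof.
move=> q0; have dT := is_derive_log_radius q0.
have dE := is_derive1_comp (C2_der1 C (log_radius q)) dT.
have h := is_derive1_comp (is_derive_expR _) (is_deriveZ (- m) (is_deriveD dE dT)).
apply: (is_derive_eq h); rewrite /cyl_profile1 /cyl_profile -/m /=.
have E (a b : R) : a *: b = a * b by [].
by rewrite !E; field; rewrite gt_eqF.
Qed.

Lemma is_derive_cyl_profile1 q : 0 < q ->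
  is_derive q (1 : R) cyl_profile1 (cyl_profile2 q).
Proof.
move=> q0; have dT := is_derive_log_radius q0; have dF := is_derive_cyl_profile q0.
have dE := is_derive1_comp (C2_der2 C (log_radius q)) dT.
have q2 : 2 * q != 0 by rewrite mulf_neq0 ?gt_eqF.
have dV := is_deriveV (f := fun q => 2 * q) q2 (is_deriveZ 2 (is_derive_id q (1 : R))).
have h := is_deriveM dF (is_deriveM (is_deriveZ (- m) (is_deriveD (is_derive_cst (1 : R) q (1 : R)) dE)) dV).
apply: (is_derive_eq h) => /=; rewrite /cyl_profile2 /cyl_profile1.
have E (a b : R) : a *: b = a * b by [].
rewrite !fctE /= !E; move: (cyl_profile _ _) (eta1 _) (eta2 _) => f e1 e2.
by field; rewrite gt_eqF.
Qed.

Lemma continuous_cyl_profile2 q : 0 < q -> {for q, continuous cyl_profile2}.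
Proof.
move=> q0; have dT := is_derive_log_radius q0.
have cT := is_derive_continuous dT.
have cF := is_derive_continuous (is_derive_cyl_profile q0).
have [_ c1] := C2_data_continuous C; have c2 := C2_cont C.
have ce1 : {for q, continuous (eta1 \o log_radius)} by apply: continuous_comp => //; exact: c1.
have ce2 : {for q, continuous (eta2 \o log_radius)} by apply: continuous_comp => //; exact: c2.
have ck (c : R) : {for q, continuous ((fun=> c) : R -> R)} by exact: cst_continuous.
have cid : {for q, continuous (fun q : R => q)} by move=> ?; exact.
have ce11 : {for q, continuous (fun q => 1 + eta1 (log_radius q))} by exact: (cvgD (ck 1) ce1).
have csq (g : R -> R) : {for q, continuous g} -> {for q, continuous (fun q => g q ^+ 2)}.
  move=> gc; apply: (@continuous_comp _ _ _ g (fun z => z ^+ 2)) => //.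
  exact: exprn_continuous.
have q2 : 4 * q ^+ 2 != 0 by rewrite mulf_neq0 ?expf_neq0 ?gt_eqF.
apply: (cvgM cF); apply: cvgM.
  exact: (cvgD (cvgB (cvgM (ck (m ^+ 2)) (csq _ ce11)) (cvgM (ck m) ce2)) (cvgM (ck (2 * m)) ce11)).
exact: (cvgV q2 (cvgM (ck 4) (csq _ cid))).
Qed.

Lemma C2_at_cyl x : 0 < dot x x ->
  C2_at (cyl eta) (fun i y => 2 * y 0 i * cyl_profile1 (dot y y))
    (fun i j y => 2 * (i == j)%:R * cyl_profile1 (dot y y)
                  + 4 * y 0 i * y 0 j * cyl_profile2 (dot y y)) x.
Proof.
exact: (C2_at_radial is_derive_cyl_profile is_derive_cyl_profile1 continuous_cyl_profile2).
Qed.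

Lemma C2_on_cyl (Omega : set 'rV[R]_n) : open Omega ->
  (forall x, Omega x -> 0 < dot x x) -> C2_on Omega (cyl eta).
Proof.
move=> oO O0; apply: (C2_at_C2_on oO _ (fun x Ox => C2_at_cyl (O0 x Ox))) => x Ox.
apply: (@continuous_comp _ _ _ (fun y => dot y y) (cyl_profile eta)).
  exact: dot_continuous.
exact: is_derive_continuous (is_derive_cyl_profile (O0 _ Ox)).
Qed.

(** Gives the eigenvalues in logarithmic coordinates: the scalar part is the one orthogonal to [x],
    and the rank one part corrects it in the radial direction. *)
Lemma conformal_hessian_cyl x : 0 < dot x x ->
  let t := log_radius (dot x x) in
  conformal_hessian (cyl eta) x =
  rank_one_mx (expR (2 * eta t) * ((1 - eta1 t ^+ 2) / 2))
    (expR (2 * eta t) * ((eta2 t + eta1 t ^+ 2 - 1) / dot x x)) x.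
Proof.
move=> x0 t; have [p1 p2] := C2_at_partial (C2_at_cyl x0).
have q0 : dot x x != 0 by rewrite gt_eqF.
(* This is [f] to the power [-4 / (n - 2)]. Both powers in the definition of the matrix are [Q]
   divided by [f] or [f ^+ 2], which makes every entry rational in the remaining quantities. *)
pose Q := expR (2 * (eta t + t)).
have QE : Q = expR (2 * eta t) * dot x x.
  rewrite /Q mulrDr expRD; congr (_ * _).
  by rewrite /t /log_radius mulrC divfK// lnK.
pose f := cyl eta x; have f0 : 0 < f by exact: expR_gt0.
have fE : f = expR (- m * (eta t + t)) by [].
have A1 : f `^ (- ((n%:R + 2) / (n%:R - 2))) * f = Q.
  rewrite fE -expRM -expRD /Q /m; congr expR; field.
  by rewrite gt_eqF.
have A2 : f `^ (- (2 * n%:R / (n%:R - 2))) * f ^+ 2 = Q.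
  rewrite fE -expRM expr2 -!expRD /Q /m; congr expR; field.
  by rewrite gt_eqF.
have sum2 : \sum_(k < n) partial k (cyl eta) x ^+ 2 =
    4 * dot x x * cyl_profile1 (dot x x) ^+ 2.
  under eq_bigr do rewrite p1.
  rewrite [in RHS]/dot mulr_sumr mulr_suml; apply: eq_bigr => k _; ring.
apply/matrixP => i j; rewrite mxE rank_one_mxE p2 !p1 sum2 -/f.
set P1 := f `^ _ in A1 *; set P2 := f `^ _ in A2 *.
rewrite [j == i]eq_sym /cyl_profile1 /cyl_profile2 -/t -/(cyl eta x) -/f.
move: (expR (2 * eta t)) QE A1 A2 => E -> A1 A2.
clearbody P1 P2 f; clear p1 p2 sum2 fE.
move: (i == j) (x 0 i) (x 0 j) (dot x x) q0 (eta1 t) (eta2 t) P1 P2 f f0 A1 A2.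
move=> d xi xj q q0 e1 e2 {}P1 {}P2 {}f {}f0 {}A1 {}A2.
have -> : P1 = E * q / f by rewrite -A1 mulfK// gt_eqF.
have -> : P2 = E * q / f ^+ 2 by rewrite -A2 mulfK// gt_eqF// exprn_gt0.
rewrite /m; case: d => /=; field.
  by rewrite q0 ?(gt_eqF f0) ?(gt_eqF N2).
by rewrite q0 ?(gt_eqF f0) ?(gt_eqF N2).
Qed.

End Profile.
End CylindricalCoordinates.

(** * Radial viscosity solutions on an annulus *)

Section Annulus.
Context {R : realType} {n : nat} (n_gt2 : (2 < n)%N).
Context {a : R} {b : \bar R} (a_ge0 : 0 <= a) (a_lt_b : (a%:E < b)%E).
Implicit Types (x y : 'rV[R]_n) (t : R).

Let i0 : 'I_n := Ordinal (ltn_trans (isT : 0 < 2)%N n_gt2).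

(** The point at logarithmic radius [t] on the first axis; a radial function is determined by its
    values there. *)
Definition ray t : 'rV[R]_n := expR t *: delta_mx 0 i0.

Lemma enorm_dot x : enorm x = Num.sqrt (dot x x).
Proof. by []. Qed.

Lemma dot_ray t : dot (ray t) (ray t) = expR t ^+ 2.
Proof.
rewrite /dot (bigD1 i0)//= !mxE !eqxx mulr1 big1 ?addr0// => i /negPf ii0.
by rewrite !mxE ii0 mulr0 mul0r.
Qed.

Lemma enorm_ray t : enorm (ray t) = expR t.
Proof. by rewrite enorm_dot dot_ray sqrtr_sqr gtr0_norm ?expR_gt0. Qed.

Lemma log_radius_ray t : log_radius (dot (ray t) (ray t)) = t.
Proof. by rewrite dot_ray -expRM_natl /log_radius expRK mulrC mulKf. Qed.

Lemma enorm_log_radius x : 0 < dot x x -> enorm x = expR (log_radius (dot x x)).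
Proof.
move=> x0; rewrite enorm_dot -[in LHS](lnK x0).
rewrite [X in expR X](_ : _ = 2%:R * log_radius (dot x x)); last first.
  by rewrite /log_radius mulrC divfK.
by rewrite expRM_natl sqrtr_sqr gtr0_norm ?expR_gt0.
Qed.

Lemma annulus_dot_gt0 x : annulus a b x -> 0 < dot x x.
Proof.
by case=> /(le_lt_trans a_ge0); rewrite enorm_dot sqrtr_gt0.
Qed.

Lemma annulus_open : open (annulus a b : set 'rV[R]_n).
Proof.
have ec : continuous (fun x => enorm x).
  move=> x; apply: (@continuous_comp _ _ _ (fun x => dot x x) Num.sqrt).
    exact: dot_continuous.
  exact: sqrt_continuous.
rewrite openE => x [ax xb].
have near_a : \forall y \near x, a < enorm y by have /cvgr_gt := ec x; exact.
have near_b : \forall y \near x, ((enorm y)%:E < b)%E.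
  case: b xb => [r|_|//].
    by rewrite lte_fin => xr; have /cvgr_lt := ec x; move/(_ _ xr).
  by near=> y; rewrite ltry.
by apply: filterS2 near_a near_b => y ? ?; split.
Unshelve. all: by end_near. Qed.

Definition log_annulus : set R := [set t | annulus a b (ray t)].

Lemma log_annulusP x : 0 < dot x x ->
  annulus a b x <-> log_annulus (log_radius (dot x x)).
Proof.
by move=> x0; rewrite /log_annulus /annulus /= enorm_ray enorm_log_radius.
Qed.

Lemma ray_continuous : continuous ray.
Proof. by move=> t; apply: cvgZl; exact: continuous_expR. Qed.

Lemma log_annulus_interval : open_interval_like log_annulus.
Proof.
have op t : log_annulus t -> \forall s \near t, log_annulus s.
  by move=> It; apply: (ray_continuous (x := t)); apply: open_nbhs_nbhs; split=> //; exact: annulus_open.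
split=> [s t r|t It|t It].
- rewrite /log_annulus /annulus /= !enorm_ray => -[as_ _] [_ tb] /andP[sr rt]; split.
    by rewrite (lt_le_trans as_)// ler_expR.
  by rewrite (le_lt_trans _ tb)// lee_fin ler_expR.
- have h : \forall s \near t^'-, log_annulus s.
    by rewrite near_withinE; apply: filterS (op t It) => s ? _.
  near t^'- => s; exists s; first by near: s; exact: nbhs_left_lt.
  by near: s.
- have h : \forall s \near t^'+, log_annulus s.
    by rewrite near_withinE; apply: filterS (op t It) => s ? _.
  near t^'+ => s; exists s; first by near: s; exact: nbhs_right_gt.
  by near: s.
Unshelve. all: by end_near. Qed.

Lemma log_annulus_neq0 : log_annulus !=set0.
Proof.
have [r ar rb] : exists2 r, a < r & (r%:E < b)%E.
  case: b a_lt_b => [r|_|//]; last by exists (a + 1); rewrite ?ltrDl ?ltry.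
  by rewrite lte_fin => ar; exists ((a + r) / 2); rewrite ?lte_fin; lra.
exists (ln r); rewrite /log_annulus /annulus /= enorm_ray lnK//.
by rewrite posrE (le_lt_trans a_ge0).
Qed.

Lemma log_radius_continuous x : 0 < dot x x ->
  {for x, continuous (fun y => log_radius (dot y y))}.
Proof.
move=> x0; apply: (@continuous_comp _ _ _ (fun y => dot y y) log_radius).
  exact: dot_continuous.
exact: is_derive_continuous (is_derive_log_radius x0).
Qed.

Section Profile.
Context {u : 'rV[R]_n -> R}.
Context (u_cont : {within annulus a b, continuous u}).
Context (u_radial : radially_symmetric_on (annulus a b) u).
Context (u_pos : forall x, annulus a b x -> 0 < u x).

Let m : R := (n%:R - 2) / 2.
Let m0 : 0 < m. Proof. exact: cyl_exponent_gt0. Qed.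

(** Inverse of [cyl] on positive radial functions. *)
Definition log_profile t : R := - m^-1 * ln (u (ray t)) - t.

Lemma log_profileE x : annulus a b x -> u x = cyl log_profile x.
Proof.
move=> Ox; have x0 := annulus_dot_gt0 Ox.
rewrite /cyl /cyl_profile /log_profile -/m subrK mulrA mulrNN divff ?gt_eqF// mul1r.
have Or : annulus a b (ray (log_radius (dot x x))) by apply/(log_annulusP x0).
rewrite lnK ?posrE ?u_pos//; apply: u_radial => //.
by rewrite enorm_ray enorm_log_radius.
Qed.

Lemma log_profile_continuous t : log_annulus t -> {for t, continuous log_profile}.
Proof.
move=> It; have cu : {for ray t, continuous u}.
  by move: u_cont; rewrite continuous_open_subspace; [apply; rewrite inE|exact: annulus_open].
have cur : {for t, continuous (u \o ray)}.
  by apply: continuous_comp; [exact: ray_continuous|].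
have cl : {for t, continuous (fun t => ln (u (ray t)))}.
  apply: (@continuous_comp R R R (u \o ray) (@ln R) t) => //.
  by apply: continuous_ln; exact: u_pos.
apply: cvgB; last exact: cvg_id.
by apply: cvgM; [exact: cvg_cst|exact: cl].
Qed.

End Profile.

Section Viscosity.
Context {Gamma : set 'rV[R]_n} (adm : admissible Gamma).
Context {mu : R} (mu_ge0 : 0 <= mu).
Context (mu_bd : boundary Gamma (vec_head_tail (- mu) 1)).
Context (e1_bd : boundary Gamma (vec_head_tail 1 0)).

Let k : R := (mu - 1) / 2.
Let n_gt0 : (0 < n)%N. Proof. exact: ltn_trans n_gt2. Qed.

(** The eigenvalue vector is determined up to a permutation, so the existential condition can be
    read off one explicit vector. *)
Lemma eigenvalues_in_rank_one (S : set 'rV[R]_n) (c d : R) x :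
  is_symmetric S -> eigenvalues_in (rank_one_mx c d x) S ->
  S (vec_head_tail (c + d * dot x x) c).
Proof.
by move=> Ssym [l hl Sl]; have [s ->] := rank_one_eigenvalues n_gt0 hl; apply: Ssym.
Qed.

Lemma scale_factor (E X Y q : R) : q != 0 -> E * X + E * (Y / q) * q = E * (X + Y).
Proof. by move=> q0; field. Qed.

Lemma closure_symmetric : is_symmetric (closure Gamma).
Proof.
move=> s x /(closure_coneP adm) h; apply/(closure_coneP adm) => e /h /(adm_sym adm s).
by congr (Gamma _); apply/rowP => i; rewrite !mxE.
Qed.

Lemma complement_symmetric : is_symmetric (~` Gamma).
Proof.
move=> s x nx /(adm_sym adm s^-1%g); congr (~ _): nx.
by congr (Gamma _); apply/rowP => i; rewrite !mxE permKV.
Qed.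

Lemma cyl_super (eta eta1 eta2 : R -> R) x : C2_data eta eta1 eta2 -> 0 < dot x x ->
  let t := log_radius (dot x x) in
  eigenvalues_in (conformal_hessian (cyl eta) x) (closure Gamma) ->
  `|eta1 t| <= 1 /\ - k * (1 - eta1 t ^+ 2) <= eta2 t.
Proof.
move=> C x0 t; rewrite (conformal_hessian_cyl n_gt2 C x0) -/t.
move=> /(eigenvalues_in_rank_one closure_symmetric) /(closure_vec_mu adm mu_ge0 mu_bd e1_bd).
rewrite scale_factor ?gt_eqF// pmulr_rge0 ?expR_gt0//.
rewrite [- mu * _]mulrCA ler_pM2l ?expR_gt0//.
case=> d0 cd; have e0 : 0 <= 1 - eta1 t ^+ 2 by move: d0; lra.
split; last by rewrite /k; move: cd; lra.
by rewrite -(@ler_pXn2r _ 2)// ?nnegrE// expr1n real_normK ?num_real// -subr_ge0.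
Qed.

Lemma cyl_sub (eta eta1 eta2 : R -> R) x : C2_data eta eta1 eta2 -> 0 < dot x x ->
  let t := log_radius (dot x x) in
  eigenvalues_in (conformal_hessian (cyl eta) x) (~` Gamma) ->
  `|eta1 t| < 1 -> eta2 t <= - k * (1 - eta1 t ^+ 2).
Proof.
move=> C x0 t; rewrite (conformal_hessian_cyl n_gt2 C x0) -/t.
move=> /(eigenvalues_in_rank_one complement_symmetric).
rewrite scale_factor ?gt_eqF// => nG e1; rewrite leNgt; apply/negP => lt.
have E0 := expR_gt0 (2 * eta t).
have e0 : 0 < 1 - eta1 t ^+ 2.
  by rewrite subr_gt0 -real_normK ?num_real// -[ltRHS](expr1n _ 2) ltr_pXn2r ?nnegrE.
apply: nG; apply: (cone_vec_mu adm mu_ge0 mu_bd).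
  by rewrite mulr_gt0// divr_gt0.
by rewrite [- mu * _]mulrCA ltr_pM2l//; move: lt; rewrite /k; lra.
Qed.

Section Only_if.
Context {u : 'rV[R]_n -> R}.
Context (u_radial : radially_symmetric_on (annulus a b) u).
Context (u_pos : forall x, annulus a b x -> 0 < u x).
Let xi := @log_profile u.

(** Turns a one-dimensional test function into a radial one: a constant makes it agree with [xi] at
    [t0]. The relation [P] stands for either order, so that both viscosity conditions are
    covered. *)
Lemma viscosity_test (eta eta1 eta2 : R -> R) t0 : C2_data eta eta1 eta2 ->
  log_annulus t0 ->
  let eta' := fun t => eta t + (xi t0 - eta t0) in
  [/\ C2_data eta' eta1 eta2, C2_on (annulus a b) (cyl eta' : 'rV[R]_n -> R),
      u (ray t0) - cyl eta' (ray t0) = 0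
    & forall P : R -> R -> Prop, 
      (\forall t \near t0, P (xi t) (eta' t)) ->
      \forall x \near ray t0, exists2 p : R * R, P p.1 p.2 &
        u x = expR (- ((n%:R - 2) / 2) * (p.1 + log_radius (dot x x))) /\
        cyl eta' x = expR (- ((n%:R - 2) / 2) * (p.2 + log_radius (dot x x)))].
Proof.
move=> C It0 eta'.
have C' : C2_data eta' eta1 eta2.
  have := C2_dataD C (C2_data_affine (xi t0 - eta t0) 0).
  case=> D1 D2 D3; split.
  - move=> t; have := D1 t; rewrite /= addr0; congr is_derive.
    by apply/funext => s /=; rewrite mul0r addr0.
  - by case: C.
  - by case: C.
split=> //.
- apply: (C2_on_cyl C'); first exact: annulus_open.
  by move=> x; exact: annulus_dot_gt0.
- rewrite log_profileE//; apply/eqP; rewrite subr_eq0 /cyl /cyl_profile log_radius_ray.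
  by rewrite /eta' -/xi [eta t0 + _]addrCA subrr addr0.
move=> P nearP.
have r0 : 0 < dot (ray t0) (ray t0) by rewrite annulus_dot_gt0.
have hc : (fun y : 'rV[R]_n => log_radius (dot y y)) @ ray t0 --> t0.
  by rewrite -[X in _ --> X]log_radius_ray; exact: log_radius_continuous.
have near1 : \forall x \near ray t0,
  P (xi (log_radius (dot x x))) (eta' (log_radius (dot x x))) by exact: (hc _ nearP).
have near2 : \forall x \near ray t0, annulus a b x.
  by apply: open_nbhs_nbhs; split=> //; exact: annulus_open.
apply: filterS2 near1 near2 => x Px Ox.
exists (xi (log_radius (dot x x)), eta' (log_radius (dot x x))) => //.
by rewrite log_profileE.
Qed.

Lemma viscosity_super_ode : viscosity_super Gamma (annulus a b) u ->
  super_ode k log_annulus xi.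
Proof.
move=> sup eta eta1 eta2 t0 C It0 near_t0.
have [C' Con touch near'] := viscosity_test C It0.
have := cyl_super (x := ray t0) C' (annulus_dot_gt0 It0).
rewrite log_radius_ray; apply.
apply: sup => //.
have /(near' (fun p q => p <= q)) : \forall t \near t0, xi t <= eta t + (xi t0 - eta t0).
  by apply: filterS near_t0 => t; lra.
apply: filterS => x [[p1 p2] /= p12 [-> ->]].
rewrite subr_ge0 ler_expR !mulNr lerN2 ler_pM2l ?lerD2r//.
exact: cyl_exponent_gt0.
Qed.

Lemma viscosity_sub_ode : viscosity_sub Gamma (annulus a b) u ->
  sub_ode k log_annulus xi.
Proof.
move=> sub eta eta1 eta2 t0 C It0 near_t0.
have [C' Con touch near'] := viscosity_test C It0.
have := cyl_sub (x := ray t0) C' (annulus_dot_gt0 It0).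
rewrite log_radius_ray; apply.
apply: sub => //.
have /(near' (fun p q => q <= p)) : \forall t \near t0, eta t + (xi t0 - eta t0) <= xi t.
  by apply: filterS near_t0 => t; lra.
apply: filterS => x [[p1 p2] /= p12 [-> ->]].
rewrite subr_le0 ler_expR !mulNr lerN2 ler_pM2l ?lerD2r//.
exact: cyl_exponent_gt0.
Qed.
End Only_if.

(** The matrix of a classical solution has its eigenvalues on the ray through (-mu, 1, ..., 1),
    which lies in the closed cone but not in the cone; the monotonicity lemmas transfer this to test
    functions. *)
Lemma cyl_viscosity_solution (u : 'rV[R]_n -> R) (eta eta1 eta2 : R -> R) :
  C2_data eta eta1 eta2 -> (forall t, eta2 t = - k * (1 - eta1 t ^+ 2)) ->
  (forall t, `|eta1 t| <= 1) -> (forall x, annulus a b x -> u x = cyl eta x) ->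
  viscosity_solution Gamma (annulus a b) u.
Proof.
move=> C ode e1 uE.
have near_annulus x : annulus a b x -> \forall y \near x, annulus a b y.
  by move=> Ox; apply: open_nbhs_nbhs; split=> //; exact: annulus_open.
have eig x : 0 < dot x x -> exists c d : R,
    [/\ conformal_hessian (cyl eta) x = rank_one_mx c d x, 0 <= c &
      c + d * dot x x = - mu * c].
  move=> x0; rewrite (conformal_hessian_cyl n_gt2 C x0) ode.
  set t := log_radius _; set c := _ * (_ / 2); set d := _ * (_ / dot x x).
  exists c, d; split=> //.
    rewrite mulr_ge0 ?expR_ge0// divr_ge0// subr_ge0.
    by rewrite -real_normK ?num_real// exprn_ile1.
  by rewrite /c /d scale_factor ?gt_eqF// /k; field.
split=> x phi Ox Cphi touch near_x; have x0 := annulus_dot_gt0 Ox.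
  have Cx := C2_on_C2_at annulus_open Cphi Ox.
  have [c [d [HE c0 cd]]] := eig x x0.
  have Cc := C2_at_cyl C x0.
  apply: (eigenvalues_in_closure_mono adm (ltnW n_gt2) x0 (a := c) (b := d)).
  - exact: conformal_hessian_sym Cx.
  - rewrite -HE; apply: (conformal_hessian_mono n_gt2 Cc Cx).
    + by rewrite -uE//; apply/eqP; rewrite -subr_eq0; apply/eqP.
    + exact: expR_gt0.
    + by apply: filterS2 near_x (near_annulus _ Ox) => y + Oy; rewrite subr_ge0 uE.
  - by rewrite cd; exact: closure_vec_muE.
have Cx := C2_on_C2_at annulus_open Cphi Ox.
have [c [d [HE c0 cd]]] := eig x x0.
have Cc := C2_at_cyl C x0.
have fE : phi x = cyl eta x.
  by rewrite -uE//; apply/esym/eqP; rewrite -subr_eq0; apply/eqP.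
apply: (eigenvalues_notin_mono adm (ltnW n_gt2) x0 (a := c) (b := d)).
- exact: conformal_hessian_sym Cx.
- rewrite -HE; apply: (conformal_hessian_mono n_gt2 Cx Cc) => //.
  + by rewrite fE; exact: expR_gt0.
  + by apply: filterS2 near_x (near_annulus _ Ox) => y + Oy; rewrite subr_le0 uE.
- by rewrite cd; exact: not_cone_vec_mu.
Qed.

End Viscosity.
End Annulus.

(** * Explicit radial formulas and the equivalence *)

Section RadialForm.
Context {R : realType} {n : nat} (n_gt2 : (2 < n)%N).
Context {a : R} {b : \bar R} (a_ge0 : 0 <= a).
Implicit Types (x : 'rV[R]_n).

Lemma cyl_affine (c d : R) x : 0 < dot x x ->
  cyl (fun t => c + d * t) x =
  expR (- ((n%:R - 2) / 2) * c) * enorm x `^ (- ((n%:R - 2) / 2 * (1 + d))).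
Proof.
move=> x0; rewrite /cyl /cyl_profile (enorm_log_radius x0) -expRM -expRD.
by congr expR; ring.
Qed.

Lemma cyl_ln_exp_comb (mu : R) (eta : R -> R) (c d : R) x : mu != 1 -> 0 < dot x x ->
  let t := log_radius (dot x x) in
  expR (- ((mu - 1) / 2) * eta t) = exp_comb ((mu - 1) / 2) c d t ->
  cyl eta x = (c * enorm x `^ (- mu + 1) + d) `^ ((n%:R - 2) / (mu - 1)).
Proof.
move=> mu1 x0 t E; have k0 : mu - 1 != 0 by rewrite subr_eq0.
rewrite (enorm_log_radius x0) -/t -expRM.
(* Multiplying [exp_comb k c d t] by [expR (- k * t)], with [2 * k = mu - 1], leaves [d] constant
   and gives the power [1 - mu] of the radius in the other term. *)
have -> : c * expR (t * (- mu + 1)) + d = expR (- ((mu - 1) / 2) * (eta t + t)).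
  rewrite [in RHS]mulrDr [in RHS]expRD E /exp_comb mulrDl -[c * _ * _]mulrA -[d * _ * _]mulrA -!expRD.
  rewrite [X in d * expR X](_ : _ = 0); last by ring.
  by rewrite expR0 mulr1; congr (c * expR _ + _); field.
by rewrite -expRM; congr expR; rewrite -/t; field.
Qed.

End RadialForm.

Unset Implicit Arguments.

Theorem theorem1p6 (R : realType) (n : nat) (Gamma : set 'rV[R]_n)
    (a : R) (b : \bar R) (u : 'rV[R]_n -> R)
    (n_ge3 : (3 <= n)%N)
    (Gamma_open : open Gamma)
    (Gamma_convex : convex_set Gamma)
    (Gamma_symmetric : is_symmetric Gamma)
    (Gamma_cone : is_cone Gamma)
    (Gamma_lower : positive_cone `<=` Gamma)
    (Gamma_upper : Gamma `<=` positive_trace)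
    (Gamma_bd : boundary Gamma (vec_head_tail 1 0))
    (a_ge0 : 0 <= a)
    (a_lt_b : (a%:E < b)%E)
    (u_cont : {within annulus a b, continuous u})
    (u_radial : radially_symmetric_on (annulus a b) u)
    (u_pos : forall x, annulus a b x -> 0 < u x) :
  viscosity_solution Gamma (annulus a b) u <->
  if mu_plus Gamma == 1 then
    exists C1 C2 : R, [/\ 0 < C1, 0 <= C2 <= n%:R - 2
      & forall x, annulus a b x -> u x = C1 * enorm x `^ (- C2)]
  else
    exists C3 C4 : R, [/\ 0 <= C3, 0 <= C4, 0 < C3 + C4
      & forall x, annulus a b x ->
          u x = (C3 * enorm x `^ (- mu_plus Gamma + 1) + C4)
                  `^ ((n%:R - 2) / (mu_plus Gamma - 1))].
Proof.
have adm : admissible Gamma by split.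
have n_gt0 : (0 < n)%N by exact: leq_trans n_ge3.
have [/andP[mu_ge0 _] mu_bd] := mu_plusP adm n_gt0.
(* From here on only nonnegativity and the boundary property of the constant are kept. *)
move: (mu_plus Gamma) mu_ge0 mu_bd => mu mu_ge0 mu_bd.
have pos (x : 'rV[R]_n) : annulus a b x -> 0 < dot x x by exact: annulus_dot_gt0.
have N2 : 0 < n%:R - 2 :> R by rewrite subr_gt0 ltr_nat.
have m0 : 0 < (n%:R - 2) / 2 :> R by rewrite divr_gt0.
pose k := (mu - 1) / 2.
pose I : set R := log_annulus n_ge3 (a := a) (b := b).
have HI : open_interval_like I by exact: log_annulus_interval.
have I0 : I !=set0 by exact: log_annulus_neq0.
pose xi := @log_profile R n n_ge3 u.
have xc t : I t -> {for t, continuous xi} by exact: log_profile_continuous.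
have uE x : annulus a b x -> u x = cyl xi x by exact: log_profileE.
split=> [[sup sub]|].
  have sup1 : super_ode k I xi by exact: viscosity_super_ode mu_bd Gamma_bd _ _ _ sup.
  have sub_ode' : sub_ode k I xi by exact: viscosity_sub_ode mu_bd _ _ _ sub.
  have IE (x : 'rV[R]_n) : annulus a b x -> I (log_radius (dot x x)).
    by move=> Ox; exact: ((log_annulusP n_ge3 (pos _ Ox)).1 Ox).
  case: eqP => [mu1|/eqP mu1].
    have k0 : k = 0 by rewrite /k mu1 subrr mul0r.
    rewrite k0 in sup1 sub_ode'.
    have [c [d [d1 xiE]]] := affine_classification HI I0 xc sup1 sub_ode'.
    (* The slope bound on [d], between -1 and 1, is exactly the range of [C2] between 0 and
       [n - 2]. *)
    exists (expR (- ((n%:R - 2) / 2) * c)), ((n%:R - 2) / 2 * (1 + d)).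
    move: d1; rewrite ler_norml => /andP[d1 d2]; split; first exact: expR_gt0.
      apply/andP; split; first by rewrite mulr_ge0 ?(ltW m0)//; lra.
      rewrite -[leRHS](divfK (_ : 2 != 0))// ler_pM2l//; lra.
    move=> x Ox; rewrite uE// -cyl_affine; last exact: pos.
    by rewrite /cyl /cyl_profile xiE//; exact: IE.
  have k0 : k != 0 by rewrite mulf_neq0 ?subr_eq0.
  have [c [d [c0 d0 cd xiE]]] := exp_classification k0 HI I0 xc sup1 sub_ode'.
  exists c, d; split=> // x Ox; rewrite uE//.
  by apply: cyl_ln_exp_comb => //; [exact: pos|exact/xiE/IE].
case: eqP => [mu1|/eqP mu1].
  move=> [C1 [C2 [C1_gt0 /andP[C2_ge0 C2_le] uE']]].
  pose m : R := (n%:R - 2) / 2.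
  (* Inverts the relation [C2 = m * (1 + d)]; likewise the intercept [- m^-1 * ln C1] reproduces the
     factor [C1]. *)
  pose d := C2 / m - 1.
  apply: (cyl_viscosity_solution n_ge3 a_ge0 adm mu_ge0 mu_bd
    (C2_data_affine (- m^-1 * ln C1) d)).
  - by move=> t; rewrite mu1 subrr mul0r oppr0 mul0r.
  - move=> _; rewrite ler_norml /d; apply/andP; split.
      by rewrite lerBrDr addrC subrr divr_ge0// ltW.
    by rewrite lerBlDr ler_pdivrMr//; move: C2_le; rewrite /m; lra.
  - move=> x Ox; rewrite uE'// cyl_affine; last exact: pos.
    rewrite -/m mulrA mulrNN divff ?gt_eqF// mul1r lnK//.
    by congr (_ * _ `^ (- _)); rewrite /d; field; rewrite gt_eqF.
move=> [c [d [c0 d0 cd uE']]].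
have k0 : k != 0 by rewrite mulf_neq0 ?subr_eq0.
apply: (cyl_viscosity_solution n_ge3 a_ge0 adm mu_ge0 mu_bd
  (C2_data_ln_exp_comb k0 c0 d0 cd)) => //.
- by move=> t; exact: exp_slope_le1.
- move=> x Ox; rewrite uE'//; apply/esym/cyl_ln_exp_comb => //; first exact: pos.
  rewrite -/k mulrA mulrNN divff// mul1r lnK// posrE.
  exact: exp_comb_gt0.
Qed.
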